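(* Let $G$ be an arbitrary edge-weighted graph that, for any $\epsilon>0$, admits a general sparse spanner oracle $\mathcal{O}_{G,1+\epsilon}$ of weak sparsity $\mathtt{Ws}_{\mathcal{O}_{G,1+\epsilon}}$. Then there exists a $(1+O(\epsilon))$-spanner for $G$ with lightness $\tilde{O}_{\epsilon}\left(\frac{\mathtt{Ws}_{\mathcal{O}_{G,1+\epsilon}}}{\epsilon}+\frac{1}{\epsilon^2}\right)$.
   Context: For an edge-weighted graph $G=(V,E,w)$ and $t>1$, a general sparse spanner oracle (GSSO) $\mathcal{O}_{G,t}$ is an algorithm that, given a subset $T\subseteq V$ and a distance parameter $L>0$, outputs in polynomial time a subgraph $\mathcal{O}_{G,t}(T,L)$ of $G$ such that $d_{\mathcal{O}_{G,t}(T,L)}(x,y)\leq t\cdot d_G(x,y)$ for every pair $x\neq y$ in $T$ with $L\leq d_G(x,y)<2L$. Its weak sparsity is $\mathtt{Ws}_{\mathcal{O}_{G,t}}=\sup_{T\subseteq V,L>0}\frac{w(\mathcal{O}_{G,t}(T,L))}{|T|L}$. An $s$-spanner of $G$ is a spanning subgraph $H$ with $d_H(u,v)\leq s\, d_G(u,v)$ for all $u,v$; its lightness is $w(H)/w(\mathrm{MST}(G))$. $\tilde{O}_\epsilon(\cdot)$ hides a factor $\log\frac1\epsilon$. *)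

(* Defs.v *)
From mathcomp Require Import all_boot all_order all_algebra.
From mathcomp Require Import all_classical all_reals all_analysis.

Set Implicit Arguments.
Unset Strict Implicit.
Unset Printing Implicit Defensive.

Import Order.TTheory GRing.Theory Num.Theory.

Local Open Scope classical_set_scope.
Local Open Scope ring_scope.

(* Finite simple graphs with positive edge weights.  An edge is a set of two
   vertices; only the values of [wt] on [edges] are ever used. *)
Record wgraph (R : realType) (V : finType) := WGraph {
  edges : {set {set V}};
  wt : {set V} -> R;
  edges_card2 : forall e, e \in edges -> #|e| = 2%N;
  wt_gt0 : forall e, e \in edges -> 0 < wt e }.

(* A subgraph of [G] is represented by its edge set, a subset of [edges G].
   Isolated vertices play no role, since all the quantities below depend only
   on the edges. *)

Definition adj (V : finType) (F : {set {set V}}) : rel V :=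
  fun u v => [set u; v]%SET \in F.

Definition weight (R : realType) (V : finType) (G : wgraph R V)
    (F : {set {set V}}) : R :=
  \sum_(e in F) wt G e.

(* Weight of the walk x :: p, edges being counted with multiplicity. *)
Definition walk_weight (R : realType) (V : finType) (G : wgraph R V)
    (x : V) (p : seq V) : R :=
  \sum_(e <- pairmap (fun u v => [set u; v]%SET) x p) wt G e.

(* The distance is +oo between different connected components. *)
Definition dist (R : realType) (V : finType) (G : wgraph R V)
    (F : {set {set V}}) (x y : V) : \bar R :=
  ereal_inf [set (walk_weight G x p)%:E |
    p in [set p : seq V | path (adj F) x p /\ last x p = y]].

Definition is_spanner (R : realType) (V : finType) (G : wgraph R V) (s : R)
    (H : {set {set V}}) : Prop :=
  H \subset edges G /\
  forall u v : V, (dist G H u v <= s%:E * dist G (edges G) u v)%E.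

Definition acyclic (V : finType) (F : {set {set V}}) : Prop :=
  forall c : seq V, ucycle (adj F) c -> (size c < 3)%N.

Definition is_spanning_tree (R : realType) (V : finType) (G : wgraph R V)
    (M : {set {set V}}) : Prop :=
  [/\ M \subset edges G, forall x y : V, connect (adj M) x y & acyclic M].

Definition is_mst (R : realType) (V : finType) (G : wgraph R V)
    (M : {set {set V}}) : Prop :=
  is_spanning_tree G M /\
  forall M' : {set {set V}}, is_spanning_tree G M' -> weight G M <= weight G M'.

(* [M] stands for a minimum spanning tree of [G]; the value does not depend on
   which one.  On a one-vertex graph this is 0 / 0 = 0. *)
Definition lightness (R : realType) (V : finType) (G : wgraph R V)
    (M H : {set {set V}}) : R :=
  weight G H / weight G M.

Definition oracle (R : realType) (V : finType) : Type :=
  {set V} -> R -> {set {set V}}.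

(* General sparse spanner oracles of stretch [t], as functions: the running time
   of the algorithm is not part of the definition. *)
Definition is_gsso (R : realType) (V : finType) (G : wgraph R V) (t : R)
    (O : oracle R V) : Prop :=
  forall (T : {set V}) (L : R), 0 < L ->
    O T L \subset edges G /\
    forall x y : V, x \in T -> y \in T -> x != y ->
      (L%:E <= dist G (edges G) x y)%E ->
      (dist G (edges G) x y < (2 * L)%:E)%E ->
      (dist G (O T L) x y <= t%:E * dist G (edges G) x y)%E.

(* May be +oo.  The empty [T] contributes 0, by division by zero, which leaves
   the supremum of the other, nonnegative, terms unchanged. *)
Definition weak_sparsity (R : realType) (V : finType) (G : wgraph R V)
    (O : oracle R V) : \bar R :=
  ereal_sup [set z : \bar R | exists (T : {set V}) (L : R),
    0 < L /\ z = (weight G (O T L) / (#|T|%:R * L))%:E].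

(* Main.v *)
Require Import Defs.
From mathcomp Require Import all_boot all_order all_algebra.
From mathcomp Require Import ring lra.

(* Idea.  Order the vertices on a line of length at most 2 w(M) whose metric dominates the tree
   metric of M, and treat each of the O(log(1/eps)) classes of scales L, L/delta, L/delta^2, ...
   separately (delta = 2^-m is of order eps), adding at each scale the edges that make all pairs
   at distance about L well connected.  The weight added is paid for by a potential: the current
   vertices are covered, up to a small distance, by a "skeleton", a family of sets of diameter
   O(delta L) whose intersection graph is connected, and the potential is the sum of their
   diameters in the current spanner.  It starts at most at 2 w(M) and never increases.  For a
   net N of mesh O(delta L), consider the pairs of net points at distance about L that are not
   yet well connected.

   - Points with many such partners, and these partners, are served by the oracle.  After
     that, their surroundings merge into sets of diameter O(L) and the potential drops by
     Omega(delta L) per point: this is the Ws / eps term.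
   - For the other pairs one selects, in order of increasing length, those that no previously
     selected one replaces up to an error O(delta L), and adds shortest paths.  Around a point p,
     either three arms of the skeleton leave p, and merging gains Omega(L); or the skeleton
     around p is a dead end that can be dropped, which also gains Omega(L), as dominating the
     vertices within O(L) is enough at the next scale; or the skeleton around p consists, up to
     a part whose cost is gained by merging, of one chain.  In the last case the positions on
     the chain show that the number of selected pairs at p is at most the gain divided by
     delta L.  As O(1/delta) points share such a gain, this costs O(1/delta^2) times the drop of
     the potential, hence the 1/eps^2 term. *)

Set Implicit Arguments.
Unset Strict Implicit.
Unset Printing Implicit Defensive.

Import Order.TTheory GRing.Theory Num.Theory.

Local Open Scope ring_scope.

(** * Finite pseudometric spaces and skeletons *)

Lemma connect_exit (T : finType) (e : rel T) (S : pred T) a b :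
  connect e a b -> S a -> ~~ S b ->
  exists c c', [/\ S c, ~~ S c' & e c c'].
Proof.
move=> /connectP[p ep ->]; elim: p a ep => [|c p IH] a /=.
  by move=> _ Sa; rewrite Sa.
move=> /andP[eac ep] Sa nS; have [Sc|nSc] := boolP (S c); first exact: IH ep Sc nS.
by exists a, c.
Qed.

(** Repeatedly take an element of least key and discard all that it covers; of two selected
    elements, the later one is then not covered by the earlier. A constant key gives nets, the
    length as key gives the selected pairs, and the opposite of the degree gives heavy separated
    sets. *)
Lemma greedy (R : realDomainType) (T : finType) (cov : rel T) (key : T -> R)
    (U : {set T}) : reflexive cov ->
  exists S : {set T}, [/\ S \subset U,
    forall u, u \in U -> exists2 s, s \in S & cov s u /\ key s <= key u &
    forall e f, e \in S -> f \in S -> e != f ->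
      (key f <= key e /\ ~~ cov f e) \/ (key e <= key f /\ ~~ cov e f)].
Proof.
move=> covxx; have [n] := ubnP #|U|; elim: n U => // n IH U ltUn.
have [->|[u0 u0U]] := set_0Vmem U.
  by exists set0; split => [|u|e f]; rewrite ?sub0set ?inE.
pose p := [arg min_(i < u0 | i \in U) key i]%O.
have [pU pmin] : p \in U /\ forall u, u \in U -> key p <= key u.
  by rewrite /p; case: arg_minP.
have [|S [SU Scov Ssep]] := IH [set u in U | ~~ cov p u].
  rewrite -ltnS; apply: leq_trans ltUn; rewrite ltnS; apply: proper_card.
  apply/properP; split; first by apply/subsetP => u; rewrite inE => /andP[].
  by exists p; rewrite // inE covxx andbF.
have SP s : s \in S -> s \in U /\ ~~ cov p s.
  by move=> /(subsetP SU); rewrite inE => /andP[].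
exists (p |: S); split.
- by apply/subsetP => s; rewrite !inE => /orP[/eqP->//|/SP[]].
- move=> u uU; have [cpu|ncpu] := boolP (cov p u).
    by exists p; rewrite ?setU11; auto.
  have [|s sS []] := Scov u; first by rewrite inE uU.
  by exists s; rewrite // inE sS orbT.
- move=> e f; rewrite !inE => /orP[/eqP->|eS] /orP[/eqP->|fS].
  + by rewrite eqxx.
  + by have [fU nf] := SP f fS; right; split => //; apply: pmin.
  + by have [eU ne] := SP e eS; left; split => //; apply: pmin.
  + exact: Ssep.
Qed.

(** Remove the leftmost point: the others lie in an interval shorter by [s]. *)
Lemma separated_card (R : realFieldType) (T : finType) (Q : {set T})
    (f : T -> R) (s lo hi : R) : 0 <= s -> lo <= hi ->
  (forall q, q \in Q -> lo <= f q <= hi) ->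
  (forall p q, p \in Q -> q \in Q -> p != q -> s <= `|f p - f q|) ->
  #|Q|%:R * s <= hi - lo + s.
Proof.
move=> s0; have [n] := ubnP #|Q|; elim: n Q lo => // n IH Q lo ltQn lohi Qlh Qsep.
have [->|[q0 q0Q]] := set_0Vmem Q; first by rewrite cards0 mul0r; lra.
pose p := [arg min_(i < q0 | i \in Q) f i]%O.
have [pQ pmin] : p \in Q /\ forall u, u \in Q -> f p <= f u.
  by rewrite /p; case: arg_minP.
have cQ : #|Q| = #|Q :\ p|.+1 by rewrite (cardsD1 p) pQ.
have plo := Qlh p pQ.
have key q : q \in Q :\ p -> f p + s <= f q.
  rewrite !inE => /andP[qp qQ]; have := Qsep q p qQ pQ qp.
  by rewrite ger0_norm ?subr_ge0 ?pmin//; lra.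
rewrite cQ -natr1 mulrDl mul1r.
have [E|[q1 q1Q]] := set_0Vmem (Q :\ p); first by rewrite E cards0 mul0r; lra.
have q1l := key q1 q1Q; have q1h : f q1 <= hi.
  by move: q1Q; rewrite inE => /andP[_ /Qlh/andP[]].
have := IH (Q :\ p) (lo + s) _ _ _ _.
have -> : hi - (lo + s) + s = hi - lo by ring.
move=> H; suff: #|Q :\ p|%:R * s <= hi - lo by lra.
apply: H.
- by move: ltQn; rewrite cQ ltnS.
- lra.
- move=> q qQ; have := key q qQ; move: qQ; rewrite inE => /andP[_ /Qlh/andP[_ ->]]; lra.
- by move=> a b; rewrite !inE => /andP[_ aQ] /andP[_ bQ]; apply: Qsep.
Qed.

Section Metric.
Variables (R : realFieldType) (X : finType).
Implicit Types (d : X -> X -> R) (F S Q : {set {set X}}) (A B C : {set X}).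

Definition pmetric d := [/\ forall x, d x x = 0, forall x y, d x y = d y x &
  forall x y z, d x z <= d x y + d y z].

Definition diam d C := \big[Num.max/0]_(p in setX C C) d p.1 p.2.

Definition cost d F := \sum_(C in F) diam d C.

Definition nerve F : rel {set X} :=
  [rel A B | [&& A \in F, B \in F & A :&: B != set0]].

Definition nerve_conn F :=
  forall A B, A \in F -> B \in F -> connect (nerve F) A B.

Definition nearby d F (p : X) (t : R) := [set C in F | [exists c in C, d p c <= t]].

Lemma pm_ge0 d x y : pmetric d -> 0 <= d x y.
Proof. by case=> d0 ds dt; have := dt x y x; rewrite d0 (ds y x); lra. Qed.

Lemma diam_ge0 d C : 0 <= diam d C.
Proof. exact: bigmax_ge_id. Qed.

Lemma diam_ge d C x y : x \in C -> y \in C -> d x y <= diam d C.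
Proof.
move=> xC yC; apply: (le_bigmax_cond 0 (j := (x, y)) (fun p => d p.1 p.2)).
by rewrite in_setX xC.
Qed.

Lemma diam_le d C t : 0 <= t -> (forall x y, x \in C -> y \in C -> d x y <= t) ->
  diam d C <= t.
Proof.
move=> t0 H; apply/bigmax_leP; split => // -[x y]; rewrite in_setX => /andP[].
exact: H.
Qed.

Lemma diam_mono d d' C : (forall x y, d' x y <= d x y) -> diam d' C <= diam d C.
Proof.
move=> H; apply: diam_le; rewrite ?diam_ge0// => x y xC yC.
exact: le_trans (H x y) (diam_ge d xC yC).
Qed.

Lemma diam_attained d C c : pmetric d -> c \in C ->
  exists a b, [/\ a \in C, b \in C & diam d C = d a b].
Proof.
move=> pd cC.
have cc : (c, c) \in setX C C by rewrite in_setX cC.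
have [[a b]] : exists2 p, p \in setX C C & forall q, q \in setX C C -> d q.1 q.2 <= d p.1 p.2.
  by case: (arg_maxP (fun p => d p.1 p.2) cc) => p pC pmax; exists p.
rewrite in_setX => /andP[aC bC] pmax.
exists a, b; split => //; apply: le_anti; rewrite diam_ge// andbT.
apply: diam_le => [|x y xC yC]; first exact: pm_ge0.
by apply: (pmax (x, y)); rewrite in_setX xC.
Qed.

Lemma cost_ge0 d F : 0 <= cost d F.
Proof. by apply: sumr_ge0 => C _; apply: diam_ge0. Qed.

Lemma cost_sub d F S : S \subset F -> cost d S <= cost d F.
Proof.
move=> SF; rewrite /cost [leRHS](big_setID S) /= (setIidPr SF) lerDl.
by apply: sumr_ge0 => C _; apply: diam_ge0.
Qed.

Lemma cost_setD d F S : S \subset F -> cost d F = cost d S + cost d (F :\: S).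
Proof. by move=> SF; rewrite /cost [LHS](big_setID S) /= (setIidPr SF). Qed.

Lemma cost_setU d S Q : [disjoint S & Q] -> cost d (S :|: Q) = cost d S + cost d Q.
Proof.
by move=> dis; rewrite /cost -bigU//=; apply: eq_bigl => C; rewrite inE.
Qed.

Lemma cost_mono d d' F : (forall x y, d' x y <= d x y) -> cost d' F <= cost d F.
Proof. by move=> H; apply: ler_sum => C _; apply: diam_mono. Qed.

Lemma cost_bigcup d (I : finType) (S : {set I}) (Y : I -> {set {set X}}) :
  (forall i j, i \in S -> j \in S -> i != j -> [disjoint Y i & Y j]) ->
  cost d (\bigcup_(i in S) Y i) = \sum_(i in S) cost d (Y i).
Proof.
have [n] := ubnP #|S|; elim: n S => // n IH S ltSn dis.
have [->|[i iS]] := set_0Vmem S; first by rewrite !big_set0 /cost big_set0.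
rewrite !(big_setD1 i iS)/= cost_setU ?IH//.
- by move: ltSn; rewrite (cardsD1 i S) iS.
- by move=> a b; rewrite !inE => /andP[_ aS] /andP[_ bS]; apply: dis.
- apply: bigcup_disjoint => j; rewrite !inE eq_sym => /andP[ij jS].
  exact: dis.
Qed.

Lemma nerveE F A B : nerve F A B = [&& A \in F, B \in F & A :&: B != set0].
Proof. by []. Qed.

Lemma nerve_sym F : symmetric (nerve F).
Proof. by move=> A B; rewrite !nerveE setIC; case: (A \in F); case: (B \in F). Qed.

Lemma nerve_connect_sym F : connect_sym (nerve F).
Proof. by apply: sym_connect_sym; apply: nerve_sym. Qed.

Lemma nerve_sub F S A B : S \subset F -> connect (nerve S) A B -> connect (nerve F) A B.
Proof.
move=> SF; apply: connect_sub => a b /= /and3P[aS bS ab].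
by apply: connect1; rewrite nerveE (subsetP SF _ aS) (subsetP SF _ bS).
Qed.

Lemma nerve_component F A B : A \in F -> connect (nerve F) A B ->
  connect (nerve [set C in F | connect (nerve F) A C]) A B.
Proof.
move=> AF /connectP[p]; elim/last_ind: p B => [|p C IH] B /=; first by move=> _ ->.
rewrite rcons_path last_rcons => /andP[ep pC] ->.
have Ap := IH _ ep erefl; apply: (connect_trans Ap).
have Ap' : connect (nerve F) A (last A p) by apply/connectP; exists p.
have AC := connect_trans Ap' (connect1 pC).
by apply: connect1; move: pC; rewrite !nerveE !inE => /and3P[-> -> ->]; rewrite Ap' AC.
Qed.

Lemma nerve_in F A B : A \in F -> connect (nerve F) A B -> B \in F.
Proof.
move=> AF AB; apply/negPn/negP => nB.
by have [c [c' [/= _ /negP nc' /and3P[_ /nc']]]] := connect_exit (S := fun C => C \in F) AB AF nB.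
Qed.

Lemma pathsum_dist d A p a b : pmetric d -> path (fun A B => A :&: B != set0) A p ->
  a \in A -> b \in last A p -> d a b <= \sum_(C <- A :: p) diam d C.
Proof.
move=> pd; case: (pd) => d0 ds dt; elim: p A a => [|B p IH] A a /=.
  by move=> _ aA bA; rewrite big_seq1 diam_ge.
move=> /andP[/set0Pn[c /setIP[cA cB]] pp] aA bB.
rewrite big_cons; apply: le_trans (dt a c b) _; apply: lerD; first exact: diam_ge.
exact: IH.
Qed.

Lemma sum_uniq_le d (s : seq {set X}) S : uniq s -> {subset s <= S} ->
  \sum_(C <- s) diam d C <= cost d S.
Proof.
move=> us sS; rewrite big_uniq// /cost [leRHS](bigID (mem s)) /=.
rewrite [X in _ <= X + _](eq_bigl (mem s)); last first.
  by move=> C /=; case: (boolP (C \in s)) => [/sS->|]//; rewrite andbF.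
by rewrite lerDl; apply: sumr_ge0 => C _; apply: diam_ge0.
Qed.

Lemma nerve_path F A B : A \in F -> connect (nerve F) A B ->
  exists p, [/\ path (fun A B => A :&: B != set0) A p, B = last A p,
    uniq (A :: p) & {subset A :: p <= F}].
Proof.
move=> AF /connectP[p0 ep0 ->]; case/shortenP: ep0 => p ep up _.
exists p; split => //.
  by apply: sub_path ep => a b /= /and3P[].
move=> C; rewrite inE => /orP[/eqP->//|Cp]; elim: p A AF ep Cp {up} => //= B' p IH A AF.
move=> /andP[/and3P[_ BF _] ep]; rewrite inE => /orP[/eqP->//|]; exact: IH ep.
Qed.

(** A simple path of the nerve visits each member at most once, so its length is at most the total
    cost. *)
Lemma conn_dist d S A B a b : pmetric d -> A \in S -> connect (nerve S) A B ->
  a \in A -> b \in B -> d a b <= cost d S.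
Proof.
move=> pd AS /(nerve_path AS)[p [ep -> up pS]] aA bB.
apply: le_trans (pathsum_dist pd ep aA bB) _; exact: sum_uniq_le.
Qed.

Lemma nearby_sub d F p t : nearby d F p t \subset F.
Proof. by apply/subsetP => C; rewrite inE => /andP[]. Qed.

Lemma nearbyP d F p t C :
  reflect (C \in F /\ exists2 c, c \in C & d p c <= t) (C \in nearby d F p t).
Proof.
rewrite inE; apply: (iffP andP) => -[CF]; first by move=> /exists_inP[c]; split=> //; exists c.
by move=> [c cC dc]; split => //; apply/exists_inP; exists c.
Qed.

Lemma nearby_mono d F p t t' : t <= t' -> nearby d F p t \subset nearby d F p t'.
Proof.
move=> tt; apply/subsetP => C /nearbyP[CF [c cC dc]]; apply/nearbyP; split => //.
by exists c => //; apply: le_trans tt.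
Qed.

(** The component of [A] among the nearby members of [Q] meets a member that misses the ball, so it
    joins [a] to a point farther than [t] from [p]. Costs are measured in the old metric [d], balls
    in the new, smaller metric [rho]. *)
Lemma arm_cost d rho F Q p s t A B a : pmetric d -> pmetric rho ->
  (forall x y, rho x y <= d x y) -> Q \subset F ->
  A \in Q -> connect (nerve Q) A B -> B \notin nearby rho F p t ->
  a \in A -> rho p a <= s ->
  t - s <= cost d [set C in Q :&: nearby rho F p t | connect (nerve (Q :&: nearby rho F p t)) A C].
Proof.
move=> pd prho rhod QF AQ AB nB aA pas.
set Q' := Q :&: nearby rho F p t; set S := [set C in Q' | _].
(* If [A] itself misses the ball, then [t < s] and the bound is trivial. *)
have [AN|nAN] := boolP (A \in nearby rho F p t); last first.
  suff: t < rho p a by have := cost_ge0 d S; lra.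
  rewrite ltNge; apply: contra nAN => pat; apply/nearbyP; split; first exact: (subsetP QF).
  by exists a.
have AQ' : A \in Q' by rewrite inE AQ.
have AS : A \in S by apply/setIdP; split; rewrite ?connect0.
have nBS : B \notin S by apply: contra nB => /setIdP[/setIP[]].
have [C [C' [CS nCS /= /and3P[CQ C'Q /set0Pn[c /setIP[cC cC']]]]]] :=
  connect_exit (S := fun C => C \in S) AB AS nBS.
have [CQ' AC] : C \in Q' /\ connect (nerve Q') A C by apply/setIdP.
have nC' : C' \notin nearby rho F p t.
  apply: contra nCS => C'N; have C'Q' : C' \in Q' by rewrite inE C'Q.
  apply/setIdP; split => //; apply: (connect_trans AC); apply: connect1.
  by rewrite nerveE CQ' C'Q'; apply/set0Pn; exists c; rewrite inE cC.
have tc : t < rho p c.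
  rewrite ltNge; apply: contra nC' => h; apply/nearbyP; split; first exact: (subsetP QF).
  by exists c.
have AC' : connect (nerve S) A C by apply: nerve_component.
have h1 := conn_dist pd AS AC' aA cC.
case: prho => _ _ rt; have := rt p a c; have := rhod a c; lra.
Qed.

End Metric.

(** * Skeletons: trichotomy, merging and trimming *)

Section Skeleton.
Variables (R : realFieldType) (X : finType).
Implicit Types (d rho : X -> X -> R) (F S Q : {set {set X}}) (A B C : {set X}).

Definition component F A := [set C in F | connect (nerve F) A C].

Lemma component_conn F A : A \in F -> nerve_conn (component F A).
Proof.
move=> AF B C /setIdP[BF AB] /setIdP[CF cAC].
apply: (connect_trans (y := A)); last exact: nerve_component.
by rewrite nerve_connect_sym; apply: nerve_component.
Qed.

(* Let F0 <= F1 be the members near p.  If some component outside F0 is joined to two pieces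
   of F1, it crosses the annulus twice, and any further unbounded component crosses it a third
   time; otherwise there is only one unbounded component, and everything else can be dropped. *)
Lemma trichotomy d rho F p R0 R1 D : pmetric d -> pmetric rho ->
  (forall x y, rho x y <= d x y) -> nerve_conn F ->
  (forall C, C \in F -> diam d C <= D) -> R0 <= R1 ->
  [\/ 3 * (R1 - R0 - D) <= cost d (nearby rho F p R1),
    exists F', [/\ F' \subset F, F' != set0, nerve_conn F',
      F :\: F' \subset nearby rho F p R1 & [disjoint nearby rho F p R0 & F']] |
    forall A B, A \in nearby rho F p R0 -> B \in nearby rho F p R0 ->
      connect (nerve (nearby rho F p R1)) A B].
Proof.
move=> pd prho rhod cF FD R01.
set F0 := nearby rho F p R0; set F1 := nearby rho F p R1.
have F0F1 : F0 \subset F1 by exact: nearby_mono.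
have F1F : F1 \subset F by exact: nearby_sub.
pose E := F :\: F0; pose comp := component E.
have EF : E \subset F by apply: subsetDl.
have compE C : comp C \subset E by apply/subsetP => C' /setIdP[].
have compF C : comp C \subset F by apply: subset_trans (compE C) EF.
have notF1E C : C \in F -> C \notin F1 -> C \in E.
  by move=> CF nC; rewrite inE CF andbT; apply: contra nC; apply: (subsetP F0F1).
have comp_adj C C' C'' : C' \in comp C -> C'' \in E -> C' :&: C'' != set0 -> C'' \in comp C.
  move=> /setIdP[C'E CC'] C''E CC; apply/setIdP; split => //.
  by apply: (connect_trans CC'); apply: connect1; rewrite nerveE C'E C''E.
have [/forall_inP H|] := boolP [forall A in F0, forall B in F0, connect (nerve F1) A B].
  by apply: Or33 => A B AF BF; have /forall_inP := H A AF; apply.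
move=> /forall_inPn[A AF0 /forall_inPn[B BF0 nAB]].
have AF := subsetP (subset_trans F0F1 F1F) A AF0.
have BF := subsetP (subset_trans F0F1 F1F) B BF0.
have [C1 C1F nC1] : exists2 C1, C1 \in F & C1 \notin F1.
  have [/subsetP FF1|/subsetPn//] := boolP (F \subset F1).
  have E1 : F1 = F by apply/eqP; rewrite eqEsubset F1F; apply/subsetP.
  by move: nAB; rewrite E1 cF.
have C1E := notF1E C1 C1F nC1.
have selfcomp C : C \in E -> C \in comp C by move=> CE; apply/setIdP.
(* If everything far from [p] lies in one component outside [F0], keeping this component alone gives
   the second alternative. *)
have [/forall_inP all1|] := boolP [forall C in F :\: F1, C \in comp C1].
  apply: Or32; exists (comp C1); split => //.
  - by apply/set0Pn; exists C1; apply: selfcomp.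
  - exact: component_conn.
  - apply/subsetP => C /setDP[CF nC]; apply/negPn/negP => nC1'.
    by move/negP: nC; apply; apply: all1; rewrite inE nC1'.
  - rewrite disjoint_subset; apply/subsetP => C CF0; rewrite inE.
    by apply/negP => /(subsetP (compE C1)); rewrite inE CF0.
move=> /forall_inPn[C2 /setDP[C2F nC2] C12]; apply: Or31.
have C2E := notF1E C2 C2F nC2.
pose arm Q Z := [set C in Q :&: F1 | connect (nerve (Q :&: F1)) Z C].
(* [Z'] shares with [Z] a point within [R0 + D] of [p], and from there the component reaches beyond
   distance [R1]. *)
have armP Z Z' C : Z \in F0 -> Z' \in comp C -> Z :&: Z' != set0 ->
    (exists2 C', C' \in comp C & C' \notin F1) -> R1 - R0 - D <= cost d (arm (comp C) Z').
  move=> /nearbyP[ZF [z zZ pz]] Z'C /set0Pn[z' /setIP[z'Z z'Z']] [C' C'C nC'].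
  have CE : C \in E.
    by move: Z'C => /setIdP[Z'E CZ']; rewrite nerve_connect_sym in CZ'; apply: nerve_in CZ'.
  have -> : R1 - R0 - D = R1 - (R0 + D) by ring.
  apply: (arm_cost pd prho rhod (compF C) Z'C _ nC' z'Z').
    by apply: component_conn.
  case: prho => _ _ rt; apply: le_trans (rt p z z') _; apply: lerD => //.
  exact: le_trans (rhod _ _) (le_trans (diam_ge d zZ z'Z) (FD _ ZF)).
have [C [Z1 [Z2 [Z1' [Z2' [Z1F Z2F [Z1C Z2C] [ZZ1 ZZ2] nZ]]]]]] :
    exists C Z1 Z2 Z1' Z2', [/\ Z1 \in F0, Z2 \in F0, Z1' \in comp C /\ Z2' \in comp C,
      Z1 :&: Z1' != set0 /\ Z2 :&: Z2' != set0 & ~~ connect (nerve F1) Z1 Z2].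
  (* [I] marks the members on the side of [A]: those of [F0] joined to [A] within [F1], and those
     outside [F0] whose component touches such a member. A walk from [A] to [B] can leave [I] only
     by stepping from a component outside [F0] back into [F0]; that component is the one sought. *)
  pose att C := [exists Z in F0, [exists Z' in comp C,
                  (Z :&: Z' != set0) && connect (nerve F1) A Z]].
  pose I C := if C \in F0 then connect (nerve F1) A C else att C.
  have IA : I A by rewrite /I AF0 connect0.
  have IB : ~~ I B by rewrite /I BF0.
  have [C [C' [IC nIC' /and3P[CF C'F CC']]]] := connect_exit (S := I) (cF A B AF BF) IA IB.
  move: IC nIC'; rewrite /I; have [CF0|nCF0] := boolP (C \in F0);
    have [C'F0|nC'F0] := boolP (C' \in F0).
  - move=> cAC /negP[]; apply: (connect_trans cAC); apply: connect1.
    by rewrite nerveE (subsetP F0F1 _ CF0) (subsetP F0F1 _ C'F0).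
  - move=> cAC /negP[]; apply/exists_inP; exists C => //; apply/exists_inP; exists C'.
      by apply: selfcomp; rewrite inE nC'F0.
    by rewrite CC'.
  - move=> /exists_inP[Z ZF0 /exists_inP[Z' /setIdP[Z'E CZ'] /andP[ZZ' AZ]]] nAC'.
    have CE : C \in E by rewrite inE nCF0.
    exists C, Z, C', Z', C; split=> //.
    + by split; [apply/setIdP|apply: selfcomp].
    + by split; rewrite // setIC.
    + by apply: contra nAC'; apply: connect_trans.
  - move=> /exists_inP[Z ZF0 /exists_inP[Z' /setIdP[Z'E CZ'] ZAZ]] /negP[].
    apply/exists_inP; exists Z => //; apply/exists_inP; exists Z' => //.
    have CE : C \in E by rewrite inE nCF0.
    have C'E : C' \in E by rewrite inE nC'F0.
    apply/setIdP; split => //; apply: connect_trans CZ'; apply: connect1.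
    by rewrite nerveE CE C'E setIC.
have Z1F1 := subsetP F0F1 _ Z1F; have Z2F1 := subsetP F0F1 _ Z2F.
have Z1'E := subsetP (compE C) _ Z1C; have Z2'E := subsetP (compE C) _ Z2C.
have CE : C \in E.
  by move: Z1C => /setIdP[_]; rewrite nerve_connect_sym; apply: nerve_in.
(* A connection inside [F1] between the two contacts would join [Z1] to [Z2]. Hence the arms that
   start at the two contacts are disjoint. *)
have nZ' : ~~ connect (nerve (comp C :&: F1)) Z1' Z2' || (Z1' \notin F1) || (Z2' \notin F1).
  apply/negPn/negP; rewrite !negb_or !negbK => /andP[/andP[conn Z1'F1] Z2'F1].
  move/negP: nZ; apply; apply: (connect_trans (y := Z1')).
    by apply: connect1; rewrite nerveE Z1F1 Z1'F1.
  apply: (connect_trans (y := Z2')); first exact: nerve_sub (subsetIr _ _) conn.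
  by apply: connect1; rewrite nerveE Z2F1 Z2'F1 setIC.
have bigC : exists2 C', C' \in comp C & C' \notin F1.
  have [CF1|/subsetPn//] := boolP (comp C \subset F1).
  move: nZ'; rewrite (setIidPl CF1) (subsetP CF1 _ Z1C) (subsetP CF1 _ Z2C) !orbF.
  by rewrite (component_conn CE).
have arm12 : [disjoint arm (comp C) Z1' & arm (comp C) Z2'].
  rewrite disjoint_subset; apply/subsetP => T /setIdP[/setIP[TC TF1] ZD1]; rewrite inE.
  apply/negP => /setIdP[_ ZD2].
  have Z1in : Z1' \in comp C :&: F1.
    by move: ZD1; rewrite nerve_connect_sym; apply: nerve_in; rewrite inE TC.
  have Z2in : Z2' \in comp C :&: F1.
    by move: ZD2; rewrite nerve_connect_sym; apply: nerve_in; rewrite inE TC.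
  move: nZ'; move: Z1in Z2in; rewrite !inE => /andP[_ ->] /andP[_ ->]; rewrite !orbF.
  by apply/negP/negPn; apply: (connect_trans ZD1); rewrite nerve_connect_sym.
(* The third arm lies in another component that also has a member outside [F1]. *)
have [C3 [C3E nC3 nCC3]] : exists C3, [/\ C3 \in E, C3 \notin F1 & C3 \notin comp C].
  have [CC1|nCC1] := boolP (C1 \in comp C); last by exists C1.
  exists C2; split => //; apply: contra C12 => /setIdP[_ CC2]; apply/setIdP; split => //.
  by apply: connect_trans CC2; rewrite nerve_connect_sym; case/setIdP: CC1.
have nA3 : A \notin comp C3 by apply/negP => /(subsetP (compE C3)); rewrite inE AF0.
have [Z3' [Z3 [Z3'C nZ3 /and3P[Z3'F Z3F ZZ3]]]] :=
  connect_exit (S := fun C => C \in comp C3) (cF C3 A (subsetP EF _ C3E) AF) (selfcomp _ C3E) nA3.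
have Z3F0 : Z3 \in F0.
  by apply/negPn/negP => nZF0; move/negP: nZ3; apply; apply: comp_adj Z3'C _ ZZ3; rewrite inE nZF0.
have arm_sub Q Z : arm Q Z \subset Q :&: F1 by apply/subsetP => T /setIdP[].
have arm3 : [disjoint arm (comp C) Z1' :|: arm (comp C) Z2' & arm (comp C3) Z3'].
  rewrite disjoint_subset; apply/subsetP => T TC; rewrite inE; apply/negP.
  move=> /(subsetP (arm_sub _ _)) /setIP[/setIdP[TE C3T] _].
  have {TC} /setIdP[_ CT] : T \in comp C.
    by case/setUP: TC => /(subsetP (arm_sub _ _)) /setIP[].
  move/negP: nCC3; apply; apply/setIdP; split => //; apply: (connect_trans CT).
  by rewrite nerve_connect_sym.
have sub : (arm (comp C) Z1' :|: arm (comp C) Z2') :|: arm (comp C3) Z3' \subset F1.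
  by rewrite !subUset !(subset_trans (arm_sub _ _)) ?subsetIr.
apply: le_trans (cost_sub d sub); rewrite !cost_setU//.
have h1 := armP _ _ _ Z1F Z1C ZZ1 bigC; have h2 := armP _ _ _ Z2F Z2C ZZ2 bigC.
have h3 : R1 - R0 - D <= cost d (arm (comp C3) Z3').
  by apply: armP Z3F0 Z3'C _ _; rewrite 1?setIC//; exists C3; rewrite ?selfcomp.
lra.
Qed.

(** The points of [V] are only required to be close to the members, not inside them: this is what
    allows dead ends to be dropped. *)
Definition skeleton d (V : {set X}) (D r : R) F :=
  [/\ nerve_conn F, forall C, C \in F -> diam d C <= D &
    forall v, v \in V -> exists2 C, C \in F & exists2 c, c \in C & d v c <= r].

Lemma cost_setU_le d F S : cost d (F :|: S) <= cost d F + cost d S.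
Proof.
have -> : F :|: S = F :|: (S :\: F) by apply/setP => C; rewrite !inE; case: (C \in F).
rewrite cost_setU ?lerD2l ?cost_sub ?subsetDl//.
by rewrite disjoint_sym disjoints_subset; apply/subsetP => C; rewrite !inE => /andP[].
Qed.

Lemma cost_imset d (I : finType) (S : {set I}) (f : I -> {set X}) :
  cost d (f @: S) <= \sum_(i in S) diam d (f i).
Proof.
rewrite /cost (partition_big_imset f) /=; apply: ler_sum => C /imsetP[i iS ->].
rewrite (bigD1 i) ?iS ?eqxx//= lerDl; apply: sumr_ge0 => j _; exact: diam_ge0.
Qed.

Lemma nerve_homo F S (f : {set X} -> {set X}) A B :
  (forall C, C \in F -> f C \in S /\ C \subset f C) ->
  connect (nerve F) A B -> connect (nerve S) (f A) (f B).
Proof.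
move=> fP /connectP[p ep ->]; elim: p A ep => //= C p IH A.
move=> /andP[/and3P[/fP[AS AfA] /fP[CS CfC] /set0Pn[x /setIP[xA xC]]] ep].
apply: (connect_trans (y := f C)); last exact: IH.
apply: connect1; rewrite nerveE AS CS; apply/set0Pn; exists x.
by rewrite inE (subsetP AfA) ?(subsetP CfC).
Qed.

(** Each group [Y i] is replaced by its union and every other member is kept. Enlarging members
    preserves the connectivity of the nerve, whether or not the groups themselves are connected. As
    the groups are disjoint, their gains add up. *)
Lemma merge d d' V D r D' r' F (I : finType) (S : {set I})
    (Y : I -> {set {set X}}) (g : I -> R) :
  (forall x y, d' x y <= d x y) -> skeleton d V D r F -> D <= D' -> r <= r' ->
  (forall i, i \in S -> Y i \subset F /\ Y i != set0) ->
  (forall i j, i \in S -> j \in S -> i != j -> [disjoint Y i & Y j]) ->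
  (forall i, i \in S -> diam d' (cover (Y i)) <= D') ->
  (forall i, i \in S -> g i <= cost d (Y i) - diam d' (cover (Y i))) ->
  exists F', skeleton d' V D' r' F' /\ cost d' F' <= cost d F - \sum_(i in S) g i.
Proof.
move=> dd [cF FD FV] DD rr YF Ydis YD Yg.
pose U := \bigcup_(i in S) Y i.
have UF : U \subset F by apply/bigcupsP => i /YF[].
pose f C := if [pick i in S | C \in Y i] is Some i then cover (Y i) else C.
have fP C : C \in F -> (exists2 i, i \in S & C \in Y i /\ f C = cover (Y i)) \/
    (C \notin U /\ f C = C).
  move=> CF; rewrite /f; case: pickP => [i /andP[iS CY]|H]; first by left; exists i.
  by right; split => //; apply/negP => /bigcupP[i iS CY]; move: (H i); rewrite iS CY.
have fsub C : C \in F -> C \subset f C.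
  by move=> CF; case: (fP C CF) => [[i iS [CY ->]]|[_ ->//]]; exact: bigcup_sup.
exists (f @: F); split; first split.
- move=> _ _ /imsetP[A AF ->] /imsetP[B BF ->]; apply: nerve_homo (cF A B AF BF).
  by move=> C CF; split; [apply: imset_f|apply: fsub].
- move=> _ /imsetP[A AF ->]; case: (fP A AF) => [[i iS [_ ->]]|[_ ->]]; first exact: YD.
  exact: le_trans (diam_mono _ dd) (le_trans (FD A AF) DD).
- move=> v /FV[C CF [c cC vc]]; exists (f C); first exact: imset_f.
  by exists c; [apply: (subsetP (fsub C CF))|apply: le_trans (dd v c) (le_trans vc rr)].
have sub : f @: F \subset (F :\: U) :|: [set cover (Y i) | i in S].
  apply/subsetP => _ /imsetP[A AF ->]; apply/setUP.
  case: (fP A AF) => [[i iS [_ ->]]|[nU ->]]; last by left; rewrite inE nU AF.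
  by right; apply/imsetP; exists i.
apply: le_trans (cost_sub d' sub) _; apply: le_trans (cost_setU_le _ _ _) _.
apply: le_trans (lerD (cost_mono _ dd) (cost_imset _ _ _)) _.
rewrite (cost_setD d UF) cost_bigcup//.
have : \sum_(i in S) g i <= \sum_(i in S) (cost d (Y i) - diam d' (cover (Y i))).
  exact: ler_sum.
rewrite sumrB; lra.
Qed.

Lemma nearby_sep d F p q s t D C : pmetric d -> (forall C, C \in F -> diam d C <= D) ->
  C \in nearby d F p s -> C \in nearby d F q t -> d p q <= s + t + D.
Proof.
move=> [d0 ds dt] FD /nearbyP[CF [a aC pa]] /nearbyP[_ [b bC qb]].
have := le_trans (diam_ge d aC bC) (FD _ CF).
have := dt p a q; have := dt a b q; rewrite (ds b q); lra.
Qed.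

(* Trimming is sequential: whether a piece may be dropped depends on the earlier trims. *)
Lemma trim d rho F (s : seq X) R0 R1 D : pmetric d -> pmetric rho ->
  (forall x y, rho x y <= d x y) -> nerve_conn F ->
  (forall C, C \in F -> diam d C <= D) -> R0 <= R1 -> uniq s ->
  (forall p q, p \in s -> q \in s -> p != q -> 2 * R1 + 2 * D < rho p q) ->
  (forall p, p \in s -> nearby rho F p R0 != set0 /\
     cost d (nearby rho F p R1) < 3 * (R1 - R0 - D) /\
     exists A B, [/\ A \in nearby rho F p R0, B \in nearby rho F p R0 &
       ~~ connect (nerve (nearby rho F p R1)) A B]) ->
  exists F', [/\ F' \subset F, nerve_conn F',
    forall C, C \in F -> C \notin F' -> exists2 p, p \in s & C \in nearby rho F p R1,
    forall p, p \in s -> [disjoint nearby rho F p R0 & F'] &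
    forall p, p \in s -> exists2 B, B \in F' & exists2 b, b \in B & rho p b <= R1 + D].
Proof.
move=> pd prho rhod cF FD R01; elim: s => [|p s IH].
  by exists F; split => // C CF; rewrite CF.
have FrD C : C \in F -> diam rho C <= D.
  by move=> CF; apply: le_trans (diam_mono _ rhod) (FD C CF).
move=> /= /andP[ps us] sep loc.
have [||F1 [F1F cF1 F1rem F1dis F1B]] := IH us.
- by move=> a b aS bS; apply: sep; rewrite inE ?aS ?bS orbT.
- by move=> q qs; apply: loc; rewrite inE qs orbT.
have pin : p \in p :: s by rewrite inE eqxx.
have D0 : 0 <= D.
  have [/set0Pn[C /nearbyP[CF _]] _] := loc p pin.
  exact: le_trans (diam_ge0 d C) (FD C CF).
have qsep q : q \in s -> 2 * R1 + 2 * D < rho q p.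
  move=> qs; apply: sep => //; first by rewrite inE qs orbT.
  by apply: contraNneq ps => <-.
(* Earlier trims took place near other points of [s], so the members near [p] are still the original
   ones. *)
have eqnear t : t <= R1 -> nearby rho F1 p t = nearby rho F p t.
  move=> tR; apply/setP => C; apply/idP/idP => /nearbyP[CF [c cC pc]]; apply/nearbyP; split.
  - exact: (subsetP F1F).
  - by exists c.
  - apply/negPn/negP => nC; have [q qs CN] := F1rem C CF nC.
    have CN' : C \in nearby rho F p R1.
      by apply/nearbyP; split => //; exists c => //; apply: le_trans tR.
    by have := nearby_sep prho FrD CN CN'; have := qsep q qs; lra.
  - by exists c.
have [ne [small [A [B [AN BN nAB]]]]] := loc p pin.
have FD1 C : C \in F1 -> diam d C <= D by move=> /(subsetP F1F) /FD.
have := trichotomy p pd prho rhod cF1 FD1 R01; rewrite !eqnear//.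
case=> [h|[F2 [F2F1 ne2 cF2 F2rem F2dis]]|h]; first by lra.
- exists F2; split => //.
  + exact: subset_trans F2F1 F1F.
  + move=> C CF nC2; have [CF1|nC1] := boolP (C \in F1).
      exists p; first by rewrite inE eqxx.
      by apply: (subsetP F2rem); rewrite inE CF1 nC2.
    by have [q qs CN] := F1rem C CF nC1; exists q; rewrite // inE qs orbT.
  + move=> q; rewrite inE => /orP[/eqP->//|/F1dis].
    rewrite !disjoints_subset => /subset_trans; apply.
    by rewrite setCS.
  + move=> q; rewrite inE => /orP[/eqP->|qs].
      have /set0Pn[C CN] := ne; have /set0Pn[T TF2] := ne2.
      have CF1 : C \in F1.
        by move: CN; rewrite -(eqnear _ R01) => /nearbyP[].
      have nC2 : C \notin F2 by rewrite (disjointFr F2dis CN).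
      (* Since [F1] is connected, some member of [F2] touches a dropped one, and dropped members lie
         near [p]. *)
      have [C1 [C2 [C1F2 nC2F2 /and3P[C1F C2F /set0Pn[c /setIP[cC1 cC2]]]]]] :=
        connect_exit (S := fun C => C \in F2) (cF1 T C (subsetP F2F1 _ TF2) CF1) TF2 nC2.
      exists C1 => //; exists c => //.
      have /nearbyP[_ [c2 c2C pc2]] : C2 \in nearby rho F p R1.
        by apply: (subsetP F2rem); rewrite inE nC2F2.
      have := le_trans (diam_ge rho c2C cC2) (FrD C2 (subsetP F1F _ C2F)).
      by case: prho => _ _ rt; have := rt p c2 c; lra.
    (* The witness of an earlier point [q] is too far from [p] to be dropped now. *)
    have [T TF1 [b bT pb]] := F1B q qs; exists T; last by exists b.
    apply/negPn/negP => nT; have /nearbyP[TF [c cT qc]] : T \in nearby rho F p R1.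
      by apply: (subsetP F2rem); rewrite inE nT.
    have := le_trans (diam_ge rho cT bT) (FrD T TF).
    case: prho => r0 rs rt; have := qsep q qs; have := rt q b p; have := rt b c p.
    rewrite (rs c p) (rs b c); lra.
- by move: (h A B AN BN); rewrite (negPf nAB).
Qed.

End Skeleton.

(** * Targets along a single chain *)

Section Chain.
Variables (R : realFieldType) (X : finType).
Implicit Types (d rho : X -> X -> R) (F S Q : {set {set X}}) (A B C : {set X}).

Definition meets : rel {set X} := fun A B => A :&: B != set0.

Definition chain_pos d (s : seq {set X}) i := \sum_(C <- take i s) diam d C.

Lemma chain_pos_ge0 d s i : 0 <= chain_pos d s i.
Proof. by apply: sumr_ge0 => C _; apply: diam_ge0. Qed.

Lemma chain_posS d s i : (i < size s)%N ->
  chain_pos d s i.+1 = chain_pos d s i + diam d (nth set0 s i).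
Proof. by move=> si; rewrite /chain_pos (take_nth set0 si) -cats1 big_cat big_seq1. Qed.

Lemma chain_dist d s i j a b : pmetric d -> sorted meets s ->
  (i <= j < size s)%N -> a \in nth set0 s i -> b \in nth set0 s j ->
  d a b <= chain_pos d s j - chain_pos d s i + diam d (nth set0 s j).
Proof.
move=> pd; elim: s i j => [|C s IH] i j ps /andP[ij js] aC bC; first by [].
case: i ij aC => [|i] ij aC.
- have -> : chain_pos d (C :: s) 0 = 0 by rewrite /chain_pos take0 big_nil.
  rewrite subr0 -chain_posS//.
  have pt : path meets C (take j s) by apply: take_path.
  apply: (pathsum_dist pd pt aC).
  rewrite (last_nth set0) size_take_min.
  have jjs : minn j (size s) = j by apply/minn_idPl.
  by rewrite jjs; case: j bC {ij js jjs pt} => //= j; rewrite nth_take.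
- case: j ij js bC => // j ij js bC /=.
  have := IH i j (path_sorted ps) _ aC bC; rewrite ltnS in ij.
  by rewrite ij -ltnS js => /(_ isT); rewrite /chain_pos /= !big_cons; lra.
Qed.

Lemma chain_dist_abs d s D i j a b : pmetric d -> sorted meets s ->
  (forall C, C \in s -> diam d C <= D) ->
  (i < size s)%N -> (j < size s)%N -> a \in nth set0 s i -> b \in nth set0 s j ->
  d a b <= `|chain_pos d s i - chain_pos d s j| + D.
Proof.
move=> pd ps sD; wlog ij : i j a b / (i <= j)%N => [H|] si sj aC bC.
  have [ij|/ltnW ij] := leqP i j; first exact: H.
  by case: (pd) => _ ds _; rewrite ds distrC; apply: H.
have h := chain_dist pd ps (introT andP (conj ij sj)) aC bC.
have := sD _ (mem_nth set0 sj); have := ler_norm (chain_pos d s j - chain_pos d s i).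
rewrite distrC; lra.
Qed.

(* Along the chain, the number f q - w q, where f is the position on the chain, separates the
   targets q of the selected pairs, and it is squeezed into a short interval as soon as the
   cycles closed by these pairs do not allow a profitable merge. *)
Lemma chain_side d rho F (s : seq {set X}) c0 p (w : X -> R) (Q : {set X})
    (u G : R) :
  pmetric d -> pmetric rho -> (forall x y, rho x y <= d x y) ->
  sorted meets s -> uniq s -> {subset s <= F} ->
  (forall C, C \in s -> diam d C <= 4 * u) ->
  (0 < size s)%N -> c0 \in nth set0 s 0 -> d p c0 <= u + G -> 0 < u -> 0 <= G ->
  (forall q, q \in Q -> exists2 C, C \in s & exists2 c, c \in C & d q c <= 2 * u) ->
  (forall q, q \in Q -> rho p q <= w q /\ w q + 40 * u < d p q) ->
  (forall q q', q \in Q -> q' \in Q -> q != q' ->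
     (w q' <= w q /\ w q + 40 * u < w q' + d q' q) \/
     (w q <= w q' /\ w q' + 40 * u < w q + d q q')) ->
  (forall Y : {set {set X}}, Y \subset F -> Y != set0 -> cost d Y - diam rho (cover Y) < G) ->
  #|Q|%:R * (18 * u) <= 4 * G.
Proof.
move=> pd prho rhod ps us sF sD s0 c0C pc0 u0 G0 Qs Qw Qsep NG.
case: (pd) => d0 ds dt; case: (prho) => r0 rs rt.
pose f := chain_pos d s.
pose idx q := find (fun C => [exists c in C, d q c <= 2 * u]) s.
have idxP q : q \in Q -> (idx q < size s)%N /\
    exists2 c, c \in nth set0 s (idx q) & d q c <= 2 * u.
  move=> /Qs[C Cs [c cC qc]].
  have h : has (fun C => [exists c in C, d q c <= 2 * u]) s.
    by apply/hasP; exists C => //; apply/exists_inP; exists c.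
  split; first by rewrite -has_find.
  by have /exists_inP[c' ? ?] := nth_find set0 h; exists c'.
have cdist i j a b : (i < size s)%N -> (j < size s)%N -> a \in nth set0 s i ->
    b \in nth set0 s j -> d a b <= `|f i - f j| + 4 * u.
  exact: chain_dist_abs.
have cdist' i j a b : (i <= j)%N -> (j < size s)%N -> a \in nth set0 s i ->
    b \in nth set0 s j -> d a b <= f j - f i + 4 * u.
  move=> ij js aC bC; have h := chain_dist pd ps (introT andP (conj ij js)) aC bC.
  by have := sD _ (mem_nth set0 js); rewrite /f; lra.
have f0 : f 0%N = 0 by rewrite /f /chain_pos take0 big_nil.
have fge i : 0 <= f i by exact: chain_pos_ge0.
(* Going from [p] to [q] along the chain costs at most [f (idx q) + G + 7 * u] in [d], which must
   exceed [w q + 40 * u]. *)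
have low q : q \in Q -> 33 * u - G <= f (idx q) - w q.
  move=> qQ; have [si [c cC qc]] := idxP q qQ; have [_ wq] := Qw q qQ.
  have := cdist' 0%N (idx q) c0 c (leq0n _) si c0C cC.
  have := dt p c0 q; have := dt c0 c q; rewrite (ds c q) f0; lra.
(* The initial part [Y] of the chain and the connection of length [w q] from [p] to [q] close up to
   a cycle in [rho], and points of a cycle are at most half its length apart. So merging [Y] gains
   about half of [f j - w q], yet less than [G]. *)
have high q : q \in Q -> f (idx q) - w q <= 3 * G + 15 * u.
  move=> qQ; have [si [cq cqC qc]] := idxP q qQ; have [wq _] := Qw q qQ.
  set j := idx q in si cqC *.
  pose Y := [set C in take j.+1 s].
  have Ys C : C \in Y -> exists2 i, (i <= j)%N & C = nth set0 s i.
    rewrite inE => CY; exists (index C (take j.+1 s)).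
      rewrite -ltnS; move: (CY); rewrite -index_mem size_take_min => /leq_trans; apply.
      exact: geq_minl.
    have := CY; rewrite -index_mem size_take_min leq_min => /andP[lj _].
    by rewrite -(nth_take set0 lj) nth_index.
  have YF : Y \subset F.
    by apply/subsetP => C; rewrite inE => /mem_take/sF.
  have Y0 : Y != set0.
    apply/set0Pn; exists (nth set0 s j); rewrite inE -(nth_take set0 (ltnSn j)).
    by apply: mem_nth; rewrite size_take_min leq_min ltnSn.
  have costY : f j <= cost d Y.
    apply: (@le_trans _ _ (f j.+1)); first by rewrite /f chain_posS// lerDl diam_ge0.
    by apply: sum_uniq_le; [rewrite take_uniq|move=> C CY; rewrite inE].
  have w0 : 0 <= w q by apply: le_trans wq; apply: pm_ge0.
  have fj := fge j.
  have diamY : diam rho (cover Y) <= (f j + w q + G + 15 * u) / 2.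
    apply: diam_le => [|a b /bigcupP[A /Ys[i ij ->] aA] /bigcupP[B /Ys[l lj ->] bB]]; first lra.
    wlog il : a b i l ij lj aA bB / (i <= l)%N => [H|].
      by have [il|/ltnW il] := leqP i l; [|rewrite rs]; apply: H il.
    have sl := leq_ltn_trans lj si.
    have h1 := le_trans (rhod _ _) (cdist' i l a b il sl aA bB).
    have h2 := le_trans (rhod _ _) (cdist' 0%N i c0 a (leq0n _) (leq_ltn_trans ij si) c0C aA).
    have h3 := le_trans (rhod _ _) (cdist' l j b cq lj si bB cqC).
    have h4 := rhod p c0; have h5 := rhod q cq.
    have := rt a c0 b; have := rt c0 p b; have := rt p q b; have := rt q cq b.
    rewrite (rs a c0) (rs c0 p) (rs cq b); lra.
  by have := NG Y YF Y0; lra.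
(* Of the margin [40 * u], rounding both targets to the chain takes [8 * u]. The difference of the
   two values of [w] either cancels or adds to the separation, according to the order of the targets
   on the chain. *)
have sep q q' : q \in Q -> q' \in Q -> q != q' ->
    32 * u <= `|(f (idx q) - w q) - (f (idx q') - w q')|.
  have key a b : a \in Q -> b \in Q -> w a <= w b -> w b + 40 * u < w a + d a b ->
      32 * u <= `|(f (idx a) - w a) - (f (idx b) - w b)|.
    move=> aQ bQ wab; have [sa [ca caC ac]] := idxP a aQ; have [sb [cb cbC bc]] := idxP b bQ.
    have := cdist _ _ _ _ sa sb caC cbC; have := dt a ca b; have := dt ca cb b.
    rewrite (ds cb b) => h1 h2 h3 h4.
    have h5 : 32 * u + (w b - w a) <= `|f (idx a) - f (idx b)| by lra.
    have [h6|h6] := lerP (f (idx b)) (f (idx a)).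
      by apply: le_trans (ler_norm _); move: h5; rewrite ger0_norm ?subr_ge0//; lra.
    by rewrite distrC; apply: le_trans (ler_norm _); move: h5; rewrite ltr0_norm ?subr_lt0//; lra.
  move=> qQ q'Q qq; case: (Qsep q q' qQ q'Q qq) => -[h1 h2]; last exact: key.
  by rewrite distrC; apply: key.
have [->|[q0 q0Q]] := set_0Vmem Q; first by rewrite cards0 mul0r; lra.
have lowhigh := le_trans (low q0 q0Q) (high q0 q0Q).
have := @separated_card R X Q (fun q => f (idx q) - w q) (32 * u) (33 * u - G) (3 * G + 15 * u)
  _ lowhigh _ sep.
(* For nonempty [Q] the surplus [14 * u] is absorbed by lowering the spacing from [32 * u] to
   [18 * u]. *)
have c1 : (1 : R) <= #|Q|%:R by rewrite ler1n card_gt0; apply/set0Pn; exists q0.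
have e1 : #|Q|%:R * (32 * u) = #|Q|%:R * (18 * u) + #|Q|%:R * (14 * u) by ring.
have e2 : 14 * u <= #|Q|%:R * (14 * u) by rewrite ler_peMl//; lra.
move=> /(_ _ _)H; have : #|Q|%:R * (32 * u) <= 3 * G + 15 * u - (33 * u - G) + 32 * u.
  by apply: H; [lra|move=> q qQ; rewrite low// high].
lra.
Qed.

End Chain.

(** * Selected pairs around one point *)

Section Local.
Variables (R : realFieldType) (X : finType).
Implicit Types (d rho : X -> X -> R) (F S Q : {set {set X}}) (A B C : {set X}).

Lemma meets_sym : symmetric (@meets X).
Proof. by move=> A B; rewrite /meets setIC. Qed.

(* If merging is never profitable near p, then all but a cheap part of the skeleton near p
   lies on one diametral chain, which carries the targets on both sides of p. *)
Lemma local_degree d rho F p (w : X -> R) (Q : {set X}) (u L G : R) :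
  pmetric d -> pmetric rho -> (forall x y, rho x y <= d x y) ->
  0 < u -> 0 <= G -> 2 * u <= L ->
  (forall C, C \in F -> diam d C <= 4 * u) ->
  (exists2 C, C \in F & exists2 c, c \in C & d p c <= u) ->
  (forall A B, A \in nearby rho F p (6 * L) -> B \in nearby rho F p (6 * L) ->
     connect (nerve (nearby rho F p (20 * L))) A B) ->
  (forall q, q \in Q -> [/\ w q <= 5 * L, rho p q <= w q, w q + 40 * u < d p q &
     u <= cost d (nearby d F q (2 * u))]) ->
  (forall q q', q \in Q -> q' \in Q -> q != q' -> 9 * u < d q q' /\
     ((w q' <= w q /\ w q + 40 * u < w q' + d q' q) \/
     (w q <= w q' /\ w q' + 40 * u < w q + d q q'))) ->
  (forall Y : {set {set X}}, Y \subset nearby rho F p (20 * L) -> Y != set0 ->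
     cost d Y - diam rho (cover Y) < G) ->
  #|Q|%:R * u <= 2 * G.
Proof.
move=> pd prho rhod u0 G0 uL FD [Cp CpF [cp cpC pcp]] conn Qw Qsep NG.
case: (pd) => d0 ds dt; case: (prho) => r0 rs rt.
set F0 := nearby rho F p (6 * L) in conn; set F1 := nearby rho F p (20 * L) in conn NG.
have F0F1 : F0 \subset F1 by apply: nearby_mono; lra.
have CpF0 : Cp \in F0.
  by apply/nearbyP; split => //; exists cp => //; have := rhod p cp; lra.
have CpF1 := subsetP F0F1 _ CpF0.
pose Z := component F1 Cp.
have F0Z : F0 \subset Z.
  by apply/subsetP => C CF0; apply/setIdP; split; [apply: (subsetP F0F1)|apply: conn].
have ZF1 : Z \subset F1 by apply/subsetP => C /setIdP[].
have ZF : Z \subset F := subset_trans ZF1 (nearby_sub _ _ _ _).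
have CpZ := subsetP F0Z _ CpF0.
have cZ : nerve_conn Z by exact: component_conn.
have cpZ : cp \in cover Z by apply/bigcupP; exists Cp.
(* A simple path between members that contain a diametral pair costs at least the diameter of the
   whole union. *)
have [a [b [/bigcupP[A AZ aA] /bigcupP[B BZ bB] dab]]] := diam_attained pd cpZ.
have [s0 [ps BE us sZ]] := nerve_path AZ (cZ A B AZ BZ).
rewrite {}BE in bB.
pose s := A :: s0; pose S := [set C in s].
have SZ : S \subset Z by apply/subsetP => C; rewrite inE; apply: sZ.
have costS : diam rho (cover Z) <= cost d S.
  apply: le_trans (diam_mono _ rhod) _; rewrite dab.
  apply: le_trans (pathsum_dist pd ps aA bB) _.
  by apply: sum_uniq_le => // C Cs; rewrite inE.
(* The union of [Z] is no more expensive than the chain, so merging [Z] would gain at least the cost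
   of what lies off the chain. *)
have offG : cost d (Z :\: S) < G.
  have Z0 : Z != set0 by apply/set0Pn; exists Cp.
  have := NG Z ZF1 Z0; by rewrite (cost_setD d SZ); lra.
(* If the member at [p] is off the chain, the off-chain component that links it to the chain costs
   less than [G]. *)
have [C0 [C0s [c0 c0C pc0]]] : exists C0, C0 \in s /\ exists2 c0, c0 \in C0 & d p c0 <= u + G.
  have [CpS|nCpS] := boolP (Cp \in s); first by exists Cp; split=> //; exists cp => //; lra.
  have CpD : Cp \in Z :\: S by apply/setDP; split; rewrite // inE.
  pose T := component (Z :\: S) Cp.
  have nAT : A \notin T by apply/negP => /setIdP[/setDP[_]]; rewrite inE mem_head.
  have CpT : Cp \in T by apply/setIdP.
  have [C [C' [/setIdP[CD CpC] nC' /and3P[CZ C'Z /set0Pn[c /setIP[cC cC']]]]]] :=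
    connect_exit (S := fun C => C \in T) (cZ Cp A CpZ AZ) CpT nAT.
  exists C'; split.
    apply: contraNT nC' => nC's; have C'D : C' \in Z :\: S by rewrite inE C'Z andbT inE.
    apply/setIdP; split => //; apply: (connect_trans CpC); apply: connect1.
    by rewrite nerveE CD C'D; apply/set0Pn; exists c; rewrite inE cC.
  exists c => //; have := conn_dist pd CpD CpC cpC cC; have := dt p cp c; lra.
have sD C : C \in s -> diam d C <= 4 * u by move=> /sZ/(subsetP ZF)/FD.
pose i0 := index C0 s.
have i0s : (i0 < size s)%N by rewrite index_mem.
have nth0 : nth set0 s i0 = C0 by rewrite nth_index.
pose on (t : seq {set X}) := [set q in Q | has (fun C => C \in nearby d F q (2 * u)) t].
have onP (t : seq {set X}) : {subset t <= s} -> uniq t -> sorted (@meets X) t ->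
    (0 < size t)%N -> nth set0 t 0 = C0 -> #|on t|%:R * (18 * u) <= 4 * G.
  move=> ts ut pt t0 tC0.
  have tD C : C \in t -> diam d C <= 4 * u by move=> /ts; apply: sD.
  have tF1 : {subset t <= F1} by move=> C /ts/sZ; apply: (subsetP ZF1).
  apply: (@chain_side _ _ d rho F1 t c0 p w (on t) u G) => //; first by rewrite tC0.
  - move=> q /setIdP[_ /hasP[C Ct /nearbyP[CF [c cC qc]]]].
    by exists C => //; exists c.
  - by move=> q /setIdP[/Qw[? ? ? ?] _].
  - by move=> q q' /setIdP[qQ _] /setIdP[q'Q _] qq; have [] := Qsep q q' qQ q'Q qq.
have ss : sorted (@meets X) s by [].
(* The chain is cut at [C0], and both halves are read outwards from [C0]. *)
have right : #|on (drop i0 s)|%:R * (18 * u) <= 4 * G.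
  apply: onP; [exact: mem_drop|exact: drop_uniq|exact: drop_sorted| |].
  - by rewrite size_drop subn_gt0.
  - by rewrite nth_drop addn0.
have left : #|on (rev (take i0.+1 s))|%:R * (18 * u) <= 4 * G.
  apply: onP.
  - by move=> C; rewrite mem_rev; apply: mem_take.
  - by rewrite rev_uniq take_uniq.
  - rewrite rev_sorted; have := take_sorted i0.+1 ss.
    by apply: sub_sorted => C C'; rewrite meets_sym.
  - by rewrite size_rev size_takel.
  - by rewrite nth_rev ?size_takel// subSS subn0 nth_take.
(* Each of these targets has its own off-chain members, of cost at least [u], and distinct targets
   share none of them. *)
pose off := [set q in Q | ~~ has (fun C => C \in nearby d F q (2 * u)) s].
have offZ : #|off|%:R * u <= G.
  have sub : \bigcup_(q in off) nearby d F q (2 * u) \subset Z :\: S.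
    apply/bigcupsP => q /setIdP[qQ noton]; apply/subsetP => C CN; apply/setDP; split; last first.
      by rewrite inE; apply: contra noton => Cs; apply/hasP; exists C.
    apply: (subsetP F0Z); move: CN => /nearbyP[CF [c cC qc]]; apply/nearbyP; split => //.
    exists c => //; have [wL pq _ _] := Qw q qQ; have := rt p q c; have := rhod q c; lra.
  apply: le_trans (ltW offG); apply: le_trans (cost_sub d sub).
  rewrite cost_bigcup; last first.
    move=> q q' /setIdP[qQ _] /setIdP[q'Q _] qq; rewrite disjoint_subset.
    apply/subsetP => C CN; rewrite inE; apply/negP => CN'.
    have [h _] := Qsep q q' qQ q'Q qq.
    have := nearby_sep pd FD CN CN'; lra.
  rewrite mulr_natl -sumr_const; apply: ler_sum => q /setIdP[/Qw[_ _ _]] //.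
have card : (#|Q| <= #|off| + (#|on (drop i0 s)| + #|on (rev (take i0.+1 s))|))%N.
  have sub : Q \subset off :|: (on (drop i0 s) :|: on (rev (take i0.+1 s))).
    apply/subsetP => q qQ; rewrite !in_setU !in_set qQ !andTb has_rev.
    rewrite (take_nth set0 i0s) has_rcons -{1}(cat_take_drop i0 s) has_cat.
    by case: has; case: has => //=; rewrite !orbT.
  apply: leq_trans (subset_leq_card sub) _; apply: leq_trans (leq_card_setU _ _) _.
  by rewrite leq_add2l leq_card_setU.
have {card} : #|Q|%:R * u <=
    (#|off|%:R + (#|on (drop i0 s)|%:R + #|on (rev (take i0.+1 s))|%:R)) * u.
  by rewrite ler_pM2r -?natrD ?ler_nat//; lra.
lra.
Qed.

End Local.

(** * One scale *)

Lemma card_bigcup_le (I T : finType) (P : pred I) (A : I -> {set T}) :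
  (#|\bigcup_(i | P i) A i| <= \sum_(i | P i) #|A i|)%N.
Proof.
elim/big_rec2: _ => [|i n B _ le]; first by rewrite cards0.
by apply: leq_trans (leq_card_setU _ _) _; rewrite leq_add2l.
Qed.

Section Level.
Variables (R : realFieldType) (X : finType).
Implicit Types (d rho : X -> X -> R) (F S Q : {set {set X}}) (A B C V : {set X}).
Implicit Types (u L : R).

(** Two far points force the skeleton to leave the ball of radius [2 * u] around [t], while it
    starts within [u] of [t]. *)
Lemma nearby_cost d V F u t x y : pmetric d -> 0 < u ->
  skeleton d V (4 * u) u F -> t \in V -> x \in V -> y \in V -> 40 * u < d x y ->
  u <= cost d (nearby d F t (2 * u)).
Proof.
move=> pd u0 [cF FD FV] tV xV yV dxy; case: (pd) => d0 ds dt.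
have [C CF [c cC tc]] := FV t tV.
have far z : z \in V -> (forall B, B \in F -> B \in nearby d F t (2 * u)) -> d t z <= 7 * u.
  move=> zV all; have [B BF [b bB zb]] := FV z zV.
  have /nearbyP[_ [b' b'B tb]] := all B BF.
  have := le_trans (diam_ge d b'B bB) (FD B BF).
  have := dt t b' z; have := dt b' b z; rewrite (ds b z); lra.
have [/forall_inP all|] := boolP [forall B in F, B \in nearby d F t (2 * u)].
  have := far x xV all; have := far y yV all; have := dt x t y; rewrite (ds x t); lra.
move=> /forall_inPn[B BF nB].
have := arm_cost pd pd (fun x y => lexx _) (subxx F) CF (cF C B CF BF) nB cC tc.
set S := [set _ in _ | _] => h; have : cost d S <= cost d (nearby d F t (2 * u)).
  by apply: cost_sub; apply/subsetP => T /setIdP[/setIP[]].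
lra.
Qed.

Lemma nearby_diam d rho F D p t (Y : {set {set X}}) : pmetric rho ->
  (forall x y, rho x y <= d x y) -> (forall C, C \in F -> diam d C <= D) ->
  0 <= D -> 0 <= t -> Y \subset nearby rho F p t ->
  diam rho (cover Y) <= 2 * (t + D).
Proof.
move=> [r0 rs rt] rhod FD D0 t0 Yp.
have key a : a \in cover Y -> rho p a <= t + D.
  move=> /bigcupP[C /(subsetP Yp)/nearbyP[CF [c cC pc]] aC].
  have := le_trans (rhod c a) (le_trans (diam_ge d cC aC) (FD C CF)).
  have := rt p c a; lra.
apply: diam_le => [|a b /key ha /key hb]; first by lra.
have := rt a p b; rewrite (rs a p); lra.
Qed.

(** Net points are grouped around separated dense centres. The skeleton near a group costs at least
    [20 * (20 * L)], more than twice the diameter of its union in [rho], so merging it gains at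
    least half of that cost. *)
Lemma gain_dense d rho V F u L (N A : {set X}) :
  pmetric d -> pmetric rho -> (forall x y, rho x y <= d x y) -> 0 < u -> 100 * u <= L ->
  skeleton d V (4 * u) u F ->
  (forall t, t \in N -> u <= cost d (nearby d F t (2 * u))) ->
  (forall t t', t \in N -> t' \in N -> t != t' -> 9 * u < d t t') ->
  A \subset N ->
  (forall a, a \in A -> 20 * (20 * L) <= #|[set t in N | rho a t <= 44 * L]|%:R * u) ->
  exists F', skeleton rho V (180 * L) (45 * L) F' /\
    cost rho F' <= cost d F - #|A|%:R * (u / 2).
Proof.
move=> pd prho rhod u0 uL skF Ncost Nsep AN Adense.
case: (skF) => cF FD FV; case: (prho) => r0 rs rt.
have covxx : reflexive (fun s t => rho s t <= 88 * L) by move=> x /=; rewrite r0; lra.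
have [S [SA Scov Ssep]] := greedy (fun=> 0 : R) A covxx.
have sep s s' : s \in S -> s' \in S -> s != s' -> 88 * L < rho s s'.
  by move=> sS s'S ss; case: (Ssep s s' sS s'S ss) => -[_]; rewrite -ltNge // rs.
(* A net point goes to the centre within [44 * L], unique by separation; failing that, to some
   centre within [88 * L], so that every point of [A] is assigned. *)
pose phi t := if [pick c in S | rho c t <= 44 * L] is Some c then Some c
  else [pick c in S | rho c t <= 88 * L].
pose grp c := [set t in N | phi t == Some c].
have phi44 c t : c \in S -> rho c t <= 44 * L -> phi t = Some c.
  move=> cS ct; rewrite /phi; case: pickP => [c' /andP[c'S c't]|/(_ c)]; last by rewrite cS ct.
  have [->//|cc] := eqVneq c' c; exfalso.
  have := sep _ _ c'S cS cc; have := rt c' t c; rewrite (rs t c); lra.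
have phiP c t : phi t = Some c -> c \in S /\ rho c t <= 88 * L.
  rewrite /phi; case: pickP => [c' /andP[c'S c't] [<-]|_]; first by split=> //; lra.
  by case: pickP => // c' /andP[c'S c't] [<-].
have phiA a : a \in A -> exists2 c, c \in S & phi a = Some c.
  move=> aA; rewrite /phi; case: pickP => [c /andP[cS _]|_]; first by exists c.
  case: pickP => [c /andP[cS _]|H]; first by exists c.
  by have [c cS [ca _]] := Scov a aA; move: (H c); rewrite cS ca.
pose Y c := \bigcup_(t in grp c) nearby d F t (2 * u).
have near0 t : t \in N -> nearby d F t (2 * u) != set0.
  move=> tN; apply: contraTneq (Ncost t tN) => ->; rewrite /cost big_set0 -ltNge; lra.
have neardis t t' : t \in N -> t' \in N -> t != t' ->
    [disjoint nearby d F t (2 * u) & nearby d F t' (2 * u)].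
  move=> tN t'N tt; rewrite disjoint_subset; apply/subsetP => C CN; rewrite inE.
  apply/negP => CN'; have := nearby_sep pd FD CN CN'; have := Nsep t t' tN t'N tt; lra.
have costY c : #|grp c|%:R * u <= cost d (Y c).
  rewrite cost_bigcup => [|t t' /setIdP[tN _] /setIdP[t'N _]]; last exact: neardis.
  by rewrite mulr_natl -sumr_const; apply: ler_sum => t /setIdP[/Ncost].
have grpc c : c \in S -> 20 * (20 * L) <= #|grp c|%:R * u.
  move=> cS; apply: le_trans (Adense c (subsetP SA c cS)) _.
  rewrite ler_pM2r// ler_nat; apply: subset_leq_card; apply/subsetP => t /setIdP[tN ct].
  by apply/setIdP; split => //; rewrite (phi44 c).
have [||||||F' [skF' costF']] := @merge R X d rho V (4 * u) u (180 * L) (45 * L) F X S Y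
  (fun c => #|grp c|%:R * (u / 2)) rhod skF _ _ _ _ _ _.
- lra.
- lra.
- move=> c cS; split; first by apply/bigcupsP => t _; apply: nearby_sub.
  have cN : c \in N := subsetP AN c (subsetP SA c cS).
  have /set0Pn[C CN] := near0 c cN; apply/set0Pn; exists C; apply/bigcupP; exists c => //.
  by apply/setIdP; split => //; rewrite (phi44 c)// r0; lra.
- move=> c c' cS c'S cc; rewrite disjoint_subset; apply/subsetP => C /bigcupP[t /setIdP[tN tc] Ct].
  rewrite inE; apply/negP => /bigcupP[t' /setIdP[t'N t'c] Ct'].
  have [tt|tt] := eqVneq t t'.
    by move: tc t'c cc; rewrite tt => /eqP -> /eqP[->]; rewrite eqxx.
  by have := neardis t t' tN t'N tt; rewrite disjoint_subset => /subsetP/(_ C Ct); rewrite inE Ct'.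
- move=> c cS; apply: (@le_trans _ _ (2 * (89 * L + 4 * u))); last lra.
  apply: (nearby_diam (p := c) prho rhod FD); [lra|lra|].
  apply/bigcupsP => t /setIdP[tN /eqP/phiP[_ ct]]; apply/subsetP => C /nearbyP[CF [b bC tb]].
  apply/nearbyP; split => //; exists b => //; have := rt c t b; have := rhod t b; lra.
- move=> c cS.
  have h : diam rho (cover (Y c)) <= 2 * (88 * L + 2 * u + 4 * u).
    apply: (nearby_diam (p := c) prho rhod FD); [lra|lra|].
    apply/bigcupsP => t /setIdP[tN /eqP/phiP[_ ct]]; apply/subsetP => C /nearbyP[CF [b bC tb]].
    apply/nearbyP; split => //; exists b => //; have := rt c t b; have := rhod t b; lra.
  have := costY c; have := grpc c cS; lra.
exists F'; split => //; apply: le_trans costF' _.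
have cardA : (#|A| <= \sum_(c in S) #|grp c|)%N.
  apply: leq_trans (card_bigcup_le _ _); apply: subset_leq_card; apply/subsetP => a aA.
  by have [c cS ca] := phiA a aA; apply/bigcupP; exists c => //; rewrite inE (subsetP AN) ?ca ?eqxx.
rewrite lerD2l lerN2 -mulr_suml ler_wpM2r//; first lra.
by rewrite -natr_sum ler_nat.
Qed.

(** The merged families stay within [20 * L] of their points, so separation by [42 * L] makes them
    disjoint. *)
Lemma gain_merge d rho V F u L (S : {set X}) (g : X -> R) :
  pmetric d -> pmetric rho -> (forall x y, rho x y <= d x y) -> 0 < u -> 100 * u <= L ->
  skeleton d V (4 * u) u F ->
  (forall p q, p \in S -> q \in S -> p != q -> 42 * L < rho p q) ->
  (forall p, p \in S -> exists Y : {set {set X}}, [/\ Y \subset nearby rho F p (20 * L),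
     Y != set0 & g p <= cost d Y - diam rho (cover Y)]) ->
  exists F', skeleton rho V (180 * L) (45 * L) F' /\
    cost rho F' <= cost d F - \sum_(p in S) g p.
Proof.
move=> pd prho rhod u0 uL skF sep hY; case: (skF) => cF FD FV.
pose good p := [pred Y : {set {set X}} | [&& Y \subset nearby rho F p (20 * L),
  Y != set0 & g p <= cost d Y - diam rho (cover Y)]].
pose Y p := odflt set0 [pick Z in good p].
have YP p : p \in S -> [/\ Y p \subset nearby rho F p (20 * L), Y p != set0 &
    g p <= cost d (Y p) - diam rho (cover (Y p))].
  move=> /hY[Z [Z1 Z2 Z3]]; rewrite /Y; case: pickP => [Z' /and3P//|/(_ Z)].
  by rewrite !inE Z1 Z2 Z3.
have FrD C : C \in F -> diam rho C <= 4 * u.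
  by move=> CF; apply: le_trans (diam_mono _ rhod) (FD C CF).
apply: (merge (Y := Y) rhod skF); [lra|lra| | | |].
- move=> p /YP[Y1 Y2 _]; split => //; exact: subset_trans Y1 (nearby_sub _ _ _ _).
- move=> p q pS qS pq; rewrite disjoint_subset; apply/subsetP => C Cp; rewrite inE.
  have [Yp _ _] := YP p pS; have [Yq _ _] := YP q qS.
  apply/negP => Cq; have := nearby_sep prho FrD (subsetP Yp C Cp) (subsetP Yq C Cq).
  have := sep p q pS qS pq; lra.
- move=> p /YP[Y1 _ _]; apply: (@le_trans _ _ (2 * (20 * L + 4 * u))); last lra.
  by apply: (nearby_diam (p := p) prho rhod FD) => //; lra.
- by move=> p /YP[].
Qed.

(** At each point of [S] the members within [6 * L] disappear; they contain an arm of cost at least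
    [L]. What remains comes within [20 * L + 4 * u] of the point, so vertices that lose their member
    are still dominated at radius [45 * L]. *)
Lemma gain_trim d rho V F u L (S : {set X}) :
  pmetric d -> pmetric rho -> (forall x y, rho x y <= d x y) -> 0 < u -> 100 * u <= L ->
  skeleton d V (4 * u) u F -> S \subset V ->
  (forall p q, p \in S -> q \in S -> p != q -> 42 * L < rho p q) ->
  (forall p, p \in S -> cost d (nearby rho F p (20 * L)) < 3 * (20 * L - 6 * L - 4 * u) /\
     exists A B, [/\ A \in nearby rho F p (6 * L), B \in nearby rho F p (6 * L) &
       ~~ connect (nerve (nearby rho F p (20 * L))) A B]) ->
  exists F', skeleton rho V (180 * L) (45 * L) F' /\
    cost rho F' <= cost d F - #|S|%:R * L.
Proof.
move=> pd prho rhod u0 uL [cF FD FV] SV sep loc; case: (prho) => r0 rs rt.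
have FrD C : C \in F -> diam rho C <= 4 * u.
  by move=> CF; apply: le_trans (diam_mono _ rhod) (FD C CF).
have R01 : 6 * L <= 20 * L by lra.
have [||F' [F'F cF' F'rem F'dis F'B]] :=
  @trim R X d rho F (enum S) (6 * L) (20 * L) (4 * u) pd prho rhod cF FD R01 (enum_uniq S).
- move=> p q; rewrite !mem_enum => pS qS pq; have := sep p q pS qS pq; lra.
- move=> p; rewrite mem_enum => pS; have [h [A [B [AN BN nAB]]]] := loc p pS.
  split; first by apply/set0Pn; exists A.
  by split => //; exists A, B.
have Smem p : p \in S -> p \in enum S by rewrite mem_enum.
exists F'; split; first split=> //.
- move=> C /(subsetP F'F)/FrD h; lra.
- move=> v vV; have [C CF [c cC vc]] := FV v vV; have rvc := rhod v c.
  have [CF'|nC] := boolP (C \in F'); first by exists C => //; exists c => //; lra.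
  have [p pS /nearbyP[_ [c' c'C pc']]] := F'rem C CF nC.
  have [B BF' [b bB pb]] := F'B p pS; exists B => //; exists b => //.
  have := le_trans (diam_ge rho cC c'C) (FrD C CF).
  have := rt v c b; have := rt c c' b; have := rt c' p b; rewrite (rs c' p); lra.
have inner p : p \in S -> L <= cost d (nearby rho F p (6 * L)).
  move=> pS; have [_ [A [B [AN BN nAB]]]] := loc p pS.
  have [C CF [c cC pc]] := FV p (subsetP SV p pS); have rpc := le_trans (rhod p c) pc.
  have [T TF nT] : exists2 T, T \in F & T \notin nearby rho F p (20 * L).
    have [/subsetP FF1|/subsetPn//] := boolP (F \subset nearby rho F p (20 * L)).
    have E1 : nearby rho F p (20 * L) = F by apply/eqP; rewrite eqEsubset nearby_sub; apply/subsetP.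
    move: nAB AN BN; rewrite E1 => nAB /nearbyP[AF _] /nearbyP[BF _].
    by rewrite cF in nAB.
  have nT6 : T \notin nearby rho F p (6 * L).
    by apply: contra nT; apply: (subsetP (nearby_mono _ _ _ R01)).
  have := arm_cost pd prho rhod (subxx F) CF (cF C T CF TF) nT6 cC rpc.
  set Q := [set _ in _ | _] => h; have : cost d Q <= cost d (nearby rho F p (6 * L)).
    by apply: cost_sub; apply/subsetP => T' /setIdP[/setIP[]].
  lra.
have sub : \bigcup_(p in S) nearby rho F p (6 * L) \subset F :\: F'.
  apply/bigcupsP => p /Smem/F'dis dis; apply/subsetP => C CN.
  by rewrite inE (disjointFr dis CN) (subsetP (nearby_sub _ _ _ _) C CN).
have := cost_sub d sub; rewrite cost_bigcup; last first.
  move=> p q pS qS pq; rewrite disjoint_subset; apply/subsetP => C Cp; rewrite inE.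
  apply/negP => Cq; have := nearby_sep prho FrD Cp Cq; have := sep p q pS qS pq; lra.
have : #|S|%:R * L <= \sum_(p in S) cost d (nearby rho F p (6 * L)).
  by rewrite mulr_natl -sumr_const; apply: ler_sum.
have := cost_setD d F'F; have := cost_mono F' rhod; lra.
Qed.

(** Elements are taken by decreasing [deg]. Each element of [U] is charged to a selected one of at
    least its degree, and no selected one is charged more than [m] times. *)
Lemma select (T : finType) (U : {set T}) (cov : rel T) (deg : T -> R) (m : R) :
  reflexive cov -> (forall t, 0 <= deg t) ->
  (forall s, s \in U -> #|[set t in U | cov s t]|%:R <= m) ->
  exists S : {set T}, [/\ S \subset U,
    forall e f, e \in S -> f \in S -> e != f -> ~~ cov e f || ~~ cov f e &
    \sum_(t in U) deg t <= m * \sum_(s in S) deg s].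
Proof.
move=> covxx deg0 Um; have [S [SU Scov Ssep]] := greedy (fun t => - deg t) U covxx.
exists S; split => //.
  by move=> e f eS fS ef; case: (Ssep e f eS fS ef) => -[_ ->]; rewrite ?orbT.
have le1 : \sum_(t in U) deg t <= \sum_(t in U) \sum_(s in S | cov s t) deg s.
  apply: ler_sum => t /Scov[s sS [cst]]; rewrite lerN2 => dst.
  rewrite (bigD1 s) ?sS//=; apply: le_trans dst _; rewrite lerDl.
  by apply: sumr_ge0.
apply: le_trans le1 _; rewrite (exchange_big_dep [in S]) /=; last by move=> ? ? _ /andP[].
rewrite mulr_sumr; apply: ler_sum => s sS.
rewrite sumr_const -mulr_natl ler_wpM2r//.
have -> : #|[pred t in U | (s \in S) && cov s t]| = #|[set t in U | cov s t]|.
  by apply: eq_card => t; rewrite !inE sS.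
exact/Um/(subsetP SU).
Qed.

End Level.

(** * Choosing the pairs of one scale and paying for them *)

Section LevelStep.
Variables (R : realFieldType) (X : finType).
Implicit Types (d rho : X -> X -> R) (F S Q : {set {set X}}) (A B C V : {set X}).
Implicit Types (u L : R).

Lemma card_pairs (T : finType) (K : {set T * T}) :
  #|K| = (\sum_p #|[set q | (p, q) \in K]|)%N.
Proof.
rewrite -sum1_card (eq_bigl (fun e => (e.1, e.2) \in K)); last by case.
rewrite -(pair_big_dep xpredT (fun p q => (p, q) \in K) (fun _ _ => 1%N)) /=.
by apply: eq_bigr => p _; rewrite -sum1_card; apply: eq_bigl => q; rewrite inE.
Qed.

(* [T] is served by the oracle, [K] consists of the selected pairs, and [rho] is any metric in
   which both are well connected.  The unit [u] of this scale becomes [45 * L] at the next one. *)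
Lemma level_step d V F (w : X -> X -> R) (E : {set X * X}) u L :
  pmetric d -> 0 < u -> 100 * u <= L -> skeleton d V (4 * u) u F ->
  (forall p q, (p, q) \in E -> [/\ p \in V, q \in V & 0 <= w p q <= 5 * L]) ->
  exists (N : {set X}) (K : {set X * X}) (T : {set X}),
  [/\ [/\ N \subset V, K \subset E & T \subset V],
    forall v, v \in V -> exists2 p, p \in N & d p v <= 9 * u,
    forall p q, p \in N -> q \in N -> (p, q) \in E ->
      [\/ d p q <= w p q + 40 * u, p \in T /\ q \in T |
        exists p' q', (p', q') \in K /\
          d p p' + w p' q' + d q' q <= w p q + 40 * u] &
    forall rho, pmetric rho -> (forall x y, rho x y <= d x y) ->
      (forall p q, (p, q) \in K -> rho p q <= w p q) ->
      (forall p q, (p, q) \in E -> p \in T -> q \in T -> rho p q <= 10 * L) ->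
      exists F', [/\ skeleton rho V (180 * L) (45 * L) F',
        #|T|%:R * u <= 2 * (cost d F - cost rho F') &
        #|K|%:R * u ^+ 2 <= 3 * (400 * (400 * L)) * (cost d F - cost rho F')]].
Proof.
move=> pd u0 uL skF EV; case: (skF) => cF FD FV; case: (pd) => d0 ds dt.
have covN : reflexive (fun s t => d s t <= 9 * u) by move=> x /=; rewrite d0; lra.
have [N [NV Ncov Nsep']] := greedy (fun=> 0 : R) V covN.
have Nsep t t' : t \in N -> t' \in N -> t != t' -> 9 * u < d t t'.
  by move=> tN t'N tt; case: (Nsep' t t' tN t'N tt) => -[_]; rewrite -ltNge // ds.
(* [bad] pairs are not yet well connected and [big] points have at least [20 * (20 * L) / u] bad
   partners. The oracle serves [T]; the pairs in [Es] go to the greedy selection, where [cov f e]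
   says that the detour through [f] replaces [e] up to [40 * u]. *)
pose bad p q := [&& (p, q) \in E, p \in N, q \in N & w p q + 40 * u < d p q].
pose big p := 20 * (20 * L) <= #|[set q | bad p q]|%:R * u.
pose T := [set t | [exists q, bad t q] && big t] :|: [set t | [exists p, bad p t && big p]].
pose Es := [set e | bad e.1 e.2 && ~~ big e.1].
pose cov := [rel f e : X * X | d e.1 f.1 + w f.1 f.2 + d f.2 e.2 <= w e.1 e.2 + 40 * u].
have covxx : reflexive cov by move=> e; rewrite /cov /= !d0; lra.
have [K [KEs Kcov Ksep]] := greedy (fun e => w e.1 e.2) Es covxx.
have Kbad p q : (p, q) \in K -> bad p q /\ ~~ big p.
  by move=> /(subsetP KEs); rewrite inE => /andP.
exists N, K, T; split; first split=> //.
- by apply/subsetP => -[p q] /Kbad[/and4P[]].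
- apply/subsetP => t; rewrite !inE => /orP[/andP[/existsP[q /and4P[_ tN _ _]] _]|].
    exact: (subsetP NV).
  by move=> /existsP[p /andP[/and4P[_ _ tN _] _]]; apply: (subsetP NV).
- by move=> v /Ncov[p pN [pv _]]; exists p.
- move=> p q pN qN pqE; have [h|h] := lerP (d p q) (w p q + 40 * u); first exact: Or31.
  have pqB : bad p q by apply/and4P.
  have [bp|nbp] := boolP (big p).
    apply: Or32; rewrite !inE; split; apply/orP; [left|right].
      by rewrite bp andbT; apply/existsP; exists q.
    by apply/existsP; exists p; rewrite pqB.
  apply: Or33; have [|[p' q'] pqK [c _]] := Kcov (p, q); first by rewrite inE pqB.
  by exists p', q'.
have L0 : 0 < L by lra.
move=> rho prho rhod rhoK rhoT; case: (prho) => r0 rs rt.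
(* A bad pair provides the two far points that [nearby_cost] asks for. If there is none, nothing is
   added and the skeleton is kept. *)
have [/existsP[p0 /existsP[q0 /and4P[E0 p0N q0N b0]]]|/existsPn nobad] :=
  boolP [exists p, exists q, bad p q]; last first.
  have {}nobad p q : bad p q = false by have /existsPn/(_ q)/negbTE := nobad p.
  have noK : K = set0.
    by apply/setP => -[p q]; rewrite inE; apply/negP => /Kbad[]; rewrite nobad.
  have noT : T = set0.
    apply/setP => t; rewrite !inE; apply/negP => /orP[/andP[/existsP[q]]|/existsP[p]];
      by rewrite nobad.
  exists F; split; rewrite ?noK ?noT ?cards0 ?mul0r.
  + split => //; first by move=> C /FD h; have := diam_mono C rhod; lra.
    by move=> v /FV[C CF [c cC vc]]; exists C => //; exists c => //; have := rhod v c; lra.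
  + by rewrite mulr_ge0 ?subr_ge0 ?cost_mono.
  + by rewrite !mulr_ge0 ?subr_ge0 ?cost_mono// ltW.
have [p0V q0V /andP[w0 _]] := EV _ _ E0.
have ncost t : t \in N -> u <= cost d (nearby d F t (2 * u)).
  by move=> tN; apply: (nearby_cost pd u0 skF (subsetP NV _ tN) p0V q0V); lra.
(* The points that are dense in the new metric. There, a big point has its bad partners within
   [10 * L], so both it and its partners are dense. *)
pose A := [set t in N | 20 * (20 * L) <= #|[set t' in N | rho t t' <= 44 * L]|%:R * u].
have AN : A \subset N by apply/subsetP => t /setIdP[].
have bigA p t : big p -> t \in N -> rho t p <= 10 * L -> t \in A.
  move=> bp tN tp; apply/setIdP; split => //; apply: (le_trans bp).
  rewrite ler_pM2r// ler_nat; apply: subset_leq_card; apply/subsetP => q; rewrite inE => pq.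
  have /and4P[pqE pN qN _] := pq; rewrite inE qN /=.
  have pT : p \in T by rewrite !inE bp andbT; apply/orP; left; apply/existsP; exists q.
  have qT : q \in T by rewrite !inE; apply/orP; right; apply/existsP; exists p; rewrite pq.
  have := rhoT p q pqE pT qT; have := rt t p q; lra.
have TA : T \subset A.
  apply/subsetP => t tT; have := tT; rewrite inE => /orP[]; rewrite inE.
    move=> /andP[/existsP[q /and4P[_ tN _ _]] bt].
    by apply: (bigA t) => //; rewrite r0; lra.
  move=> /existsP[p /andP[pt bp]]; have /and4P[ptE pN tN _] := pt.
  apply: (bigA p) => //; rewrite rs; apply: rhoT => //.
  by rewrite !inE bp andbT; apply/orP; left; apply/existsP; exists t.
have Adense a : a \in A -> 20 * (20 * L) <= #|[set t in N | rho a t <= 44 * L]|%:R * u.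
  by move=> /setIdP[].
have notA a : a \in N -> a \notin A -> #|[set t in N | rho a t <= 44 * L]|%:R * u <= 20 * (20 * L).
  by move=> aN; rewrite inE aN /= -ltNge => /ltW.
clearbody A.
pose deg p : R := #|[set q | (p, q) \in K]|%:R.
have deg0 p : 0 <= deg p by apply: ler0n.
have degN p : 0 < deg p -> p \in N /\ ~~ big p.
  rewrite ltr0n card_gt0 => /set0Pn[q]; rewrite inE => /Kbad[/and4P[_ pN _ _]]//.
have degu p : deg p * u <= 20 * (20 * L).
  have := deg0 p; rewrite le_eqVlt => /orP[/eqP<-|/degN[_]]; first by rewrite mul0r; lra.
  rewrite -ltNge => /ltW; apply: le_trans; rewrite ler_pM2r// ler_nat.
  by apply: subset_leq_card; apply/subsetP => q; rewrite !inE => /Kbad[].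
have degE p : deg p = #|[set q | (p, q) \in K]|%:R by [].
have cardKE : #|K|%:R = \sum_p deg p by rewrite card_pairs natr_sum.
clearbody deg.
(* The other points of positive degree are split according to whether some merge near [p] gains a
   fixed fraction of [deg p * u]: those of [U1] will be merged, those of [U2] trimmed. *)
pose MG p := [exists Y : {set {set X}}, [&& Y \subset nearby rho F p (20 * L), Y != set0 &
  deg p * u / 400 <= cost d Y - diam rho (cover Y)]].
pose U1 := [set p in N | [&& p \notin A, 0 < deg p & MG p]].
pose U2 := [set p in N | [&& p \notin A, 0 < deg p & ~~ MG p]].
(* Outside [A] a ball of radius [42 * L] contains at most [20 * (20 * L) / u] net points, so passing
   to separated points loses at most this factor of the total degree. *)
have Um (U : {set X}) : {subset U <= N} -> (forall p, p \in U -> p \notin A) ->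
    forall s, s \in U -> #|[set t in U | rho s t <= 42 * L]|%:R <= 20 * (20 * L) / u.
  move=> UN UA s sU; rewrite ler_pdivlMr//.
  apply: le_trans (notA s (UN s sU) (UA s sU)).
  rewrite ler_pM2r// ler_nat; apply: subset_leq_card; apply/subsetP => t /setIdP[tU st].
  by rewrite inE UN//=; lra.
have cov42 : reflexive (fun s t => rho s t <= 42 * L) by move=> x /=; rewrite r0; lra.
have U1N : {subset U1 <= N} by move=> p /setIdP[].
have U2N : {subset U2 <= N} by move=> p /setIdP[].
have U1A p : p \in U1 -> p \notin A by move=> /setIdP[_ /and3P[]].
have U2A p : p \in U2 -> p \notin A by move=> /setIdP[_ /and3P[]].
have U1P p : p \in U1 -> MG p by move=> /setIdP[_ /and3P[]].
have U2P p : p \in U2 -> 0 < deg p /\ ~~ MG p by move=> /setIdP[_ /and3P[]].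
have UP p : p \in N -> p \notin A -> 0 < deg p -> (p \in U1) || (p \in U2).
  by move=> pN pA dp; rewrite !inE pN pA dp /= orbN.
clearbody U1 U2.
have [S1 [S1U S1sep S1sum]] := select cov42 deg0 (Um U1 U1N U1A).
have [S2 [S2U S2sep S2sum]] := select cov42 deg0 (Um U2 U2N U2A).
have sep42 (S : {set X}) : (forall e f, e \in S -> f \in S -> e != f ->
    ~~ (rho e f <= 42 * L) || ~~ (rho f e <= 42 * L)) ->
    forall p q, p \in S -> q \in S -> p != q -> 42 * L < rho p q.
  by move=> h p q pS qS pq; have := h p q pS qS pq; rewrite (rs q p) orbb -ltNge.
have [FA [skA costA]] : exists F', skeleton rho V (180 * L) (45 * L) F' /\
    cost rho F' <= cost d F - #|A|%:R * (u / 2).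
  by apply: (gain_dense pd prho rhod u0 uL skF ncost Nsep AN).
have [FM [skM costM]] : exists F', skeleton rho V (180 * L) (45 * L) F' /\
    cost rho F' <= cost d F - \sum_(p in S1) (deg p * u / 400).
  apply: (gain_merge pd prho rhod u0 uL skF (sep42 _ S1sep)) => p /(subsetP S1U).
  by move=> /U1P/existsP[Y /and3P[]]; exists Y.
have [FT [skT costT]] : exists F', skeleton rho V (180 * L) (45 * L) F' /\
    cost rho F' <= cost d F - #|S2|%:R * L.
  apply: (gain_trim pd prho rhod u0 uL skF _ (sep42 _ S2sep)).
    by apply/subsetP => p /(subsetP S2U)/U2N/(subsetP NV).
  move=> p /(subsetP S2U) pU2; have pN := U2N p pU2; have [dp nMG] := U2P p pU2.
  have NG (Y : {set {set X}}) : Y \subset nearby rho F p (20 * L) -> Y != set0 ->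
      cost d Y - diam rho (cover Y) < deg p * u / 400.
    move=> Yp Y0; rewrite ltNge; apply: contra nMG => h.
    by apply/existsP; exists Y; rewrite Yp Y0.
  have dpu : 0 < deg p * u by rewrite mulr_gt0.
  have [Cp CpF [cp cpC pcp]] := FV p (subsetP NV p pN).
  have CpN t : L <= t -> Cp \in nearby rho F p t.
    move=> Lt; apply/nearbyP; split => //; exists cp => //.
    by have := rhod p cp; move: pcp uL u0 Lt; clear; lra.
  split.
    (* As merging all of it is not profitable, the skeleton near [p] costs less than
       [41 * L + 8 * u], too little for three arms. *)
    have Y0 : nearby rho F p (20 * L) != set0.
      by apply/set0Pn; exists Cp; apply: CpN; move: L0; clear; lra.
    have := NG _ (subxx _) Y0; have := degu p.
    have : diam rho (cover (nearby rho F p (20 * L))) <= 2 * (20 * L + 4 * u).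
      by apply: (nearby_diam (p := p) prho rhod FD) => //; move: u0 L0; clear; lra.
    by move: uL u0; clear; lra.
  have [/forall_inP conn|] := boolP [forall A in nearby rho F p (6 * L),
      forall B in nearby rho F p (6 * L), connect (nerve (nearby rho F p (20 * L))) A B].
    have conn' B C : B \in nearby rho F p (6 * L) -> C \in nearby rho F p (6 * L) ->
        connect (nerve (nearby rho F p (20 * L))) B C.
      by move=> BN CN; have /forall_inP := conn B BN; apply.
    (* If the inner members were connected near [p], [local_degree] would bound [deg p * u] by a
       two-hundredth of itself. *)
    exfalso; suff : deg p * u <= 2 * (deg p * u / 400) by move: dpu; clear; lra.
    have uL' : 2 * u <= L by move: uL u0; clear; lra.
    have G0 : 0 <= deg p * u / 400 by move: dpu; clear; lra.
    rewrite {1}degE; apply: (@local_degree R X d rho F p (w p) [set q | (p, q) \in K] u L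
      (deg p * u / 400) pd prho rhod u0 G0 uL' FD _ conn' _ _ NG).
    - by exists Cp => //; exists cp.
    - move=> q; rewrite inE => pqK; have [/and4P[pqE _ qN wd] _] := Kbad p q pqK.
      by have [_ _ /andP[_ w5]] := EV _ _ pqE; split => //; [apply: rhoK|apply: ncost].
    - move=> q q'; rewrite !inE => qK q'K qq.
      have [/and4P[_ _ qN _] _] := Kbad p q qK; have [/and4P[_ _ q'N _] _] := Kbad p q' q'K.
      split; first exact: Nsep.
      have ne : (p, q) != (p, q') by apply: contra qq => /eqP[->].
      case: (Ksep (p, q) (p, q') qK q'K ne) => -[h1]; rewrite /cov /= d0 add0r -ltNge => h2.
        by left.
      by right.
  move=> /forall_inPn[B BN /forall_inPn[C CN nBC]].
  by exists B, C.
have sumS2 : \sum_(p in S2) (deg p * u / 400) <= #|S2|%:R * L.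
  rewrite mulr_natl -sumr_const; apply: ler_sum => p _; have := degu p; clear; lra.
have cardK : #|K|%:R <= \sum_(p in A) deg p + \sum_(p in U1) deg p + \sum_(p in U2) deg p.
  rewrite cardKE !(big_mkcond (fun p => p \in _)) /= -!big_split /=.
  apply: ler_sum => p _; have dp := deg0 p.
  have [pA|npA] := boolP (p \in A); first by do 2 case: ifP => _; move: dp; clear; lra.
  move: dp; rewrite le_eqVlt => /orP[/eqP<-|dp]; first by do 2 case: ifP => _; rewrite !addr0.
  have [pN _] := degN p dp.
  by case/orP: (UP p pN npA dp) => ->; case: ifP => _; move: dp; clear; lra.
have sumA : u * \sum_(p in A) deg p <= #|A|%:R * (20 * (20 * L)).
  rewrite mulr_sumr mulr_natl -sumr_const; apply: ler_sum => p _.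
  by rewrite mulrC.
have uU (U S : {set X}) g : \sum_(p in U) deg p <= 20 * (20 * L) / u * \sum_(p in S) deg p ->
    \sum_(p in S) (deg p * u / 400) <= g ->
    u ^+ 2 * \sum_(p in U) deg p <= 400 * (400 * L) * g.
  move=> h hg; apply: (@le_trans _ _ (u ^+ 2 * (20 * (20 * L) / u * \sum_(p in S) deg p))).
    by rewrite ler_wpM2l// sqr_ge0.
  have -> : u ^+ 2 * (20 * (20 * L) / u * \sum_(p in S) deg p) =
      400 * (400 * L) * \sum_(p in S) (deg p * u / 400).
    by rewrite -!mulr_suml; field; rewrite gt_eqF.
  by rewrite ler_wpM2l// !mulr_ge0// ltW.
have final g : #|A|%:R * (u / 2) <= g -> \sum_(p in S1) (deg p * u / 400) <= g ->
    #|S2|%:R * L <= g -> #|T|%:R * u <= 2 * g /\ #|K|%:R * u ^+ 2 <= 3 * (400 * (400 * L)) * g.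
  move=> gA gM gT; have hU1 := uU U1 S1 g S1sum gM.
  have hU2 := uU U2 S2 g S2sum (le_trans sumS2 gT).
  have hA : #|A|%:R * u <= 2 * g by move: gA; clear; lra.
  split; first by apply: le_trans hA; rewrite ler_pM2r// ler_nat subset_leq_card.
  have -> : 3 * (400 * (400 * L)) * g =
      400 * L * (400 * g) + 400 * (400 * L) * g + 400 * (400 * L) * g.
    by ring.
  apply: (@le_trans _ _ ((\sum_(p in A) deg p + \sum_(p in U1) deg p +
      \sum_(p in U2) deg p) * u ^+ 2)); first by rewrite ler_pM2r// exprn_gt0.
  rewrite mulrC !mulrDr; apply: lerD => //; apply: lerD => //.
  apply: (@le_trans _ _ (u * (#|A|%:R * (20 * (20 * L))))).
    by rewrite expr2 -mulrA ler_pM2l.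
  have -> : u * (#|A|%:R * (20 * (20 * L))) = 400 * L * (#|A|%:R * u) by ring.
  have g0 : 0 <= g by apply: le_trans gA; rewrite mulr_ge0// ltW// divr_gt0.
  apply: ler_wpM2l; first by rewrite mulr_ge0// ltW.
  by move: hA g0; clear; lra.
(* The three modifications are not combined: the cheapest of the three skeletons gains at least as
   much as each of them. *)
have best F' : skeleton rho V (180 * L) (45 * L) F' ->
    cost rho F' <= cost rho FA -> cost rho F' <= cost rho FM -> cost rho F' <= cost rho FT ->
    exists F', [/\ skeleton rho V (180 * L) (45 * L) F',
      #|T|%:R * u <= 2 * (cost d F - cost rho F') &
      #|K|%:R * u ^+ 2 <= 3 * (400 * (400 * L)) * (cost d F - cost rho F')].
  move=> sk h1 h2 h3; exists F'.
  by have [||| hT hK] := final (cost d F - cost rho F'); [lra|lra|lra|].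
have [hAM|/ltW hMA] := lerP (cost rho FA) (cost rho FM).
  have [hAT|/ltW hTA] := lerP (cost rho FA) (cost rho FT); first exact: best hAM hAT.
  by apply: (best FT) => //; lra.
have [hMT|/ltW hTM] := lerP (cost rho FM) (cost rho FT); first exact: best hMT.
by apply: (best FT) => //; lra.
Qed.

End LevelStep.

(** * Graphs and their distances *)

From mathcomp Require Import all_classical all_reals all_analysis.
From mathcomp Require Import fintype finset.

Section Walks.
Variables (R : realType) (V : finType) (G : wgraph R V).
Implicit Types (F H : {set {set V}}) (x y z : V) (p : seq V).

Lemma weight_mono F H : H \subset edges G -> F \subset H -> weight G F <= weight G H.
Proof.
move=> HE FH; rewrite /weight [leRHS](big_setID F) /= (setIidPr FH) lerDl.
by apply: sumr_ge0 => e /setDP[/(subsetP HE)/wt_gt0/ltW].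
Qed.

Lemma weight_ge0 F : F \subset edges G -> 0 <= weight G F.
Proof. by move=> FE; apply: sumr_ge0 => e /(subsetP FE)/wt_gt0/ltW. Qed.

Lemma weight_setU F H : H \subset edges G ->
  weight G (F :|: H) <= weight G F + weight G H.
Proof.
move=> HE; have -> : F :|: H = F :|: (H :\: F).
  by apply/setP => e; rewrite !inE; case: (e \in F).
have dis : [disjoint F & H :\: F].
  by rewrite disjoint_sym disjoints_subset; apply/subsetP => e; rewrite !inE => /andP[].
have -> : weight G (F :|: (H :\: F)) = weight G F + weight G (H :\: F).
  by rewrite /weight -bigU//=; apply: eq_bigl => e; rewrite inE.
by rewrite lerD2l; apply: weight_mono => //; apply: subsetDl.
Qed.

Lemma weight_bigcup (I : finType) (P : pred I) (A : I -> {set {set V}}) :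
  (forall i, P i -> A i \subset edges G) ->
  weight G (\bigcup_(i | P i) A i) <= \sum_(i | P i) weight G (A i).
Proof.
move=> AE; pose K (B : {set {set V}}) s := B \subset edges G /\ weight G B <= s.
suff [] : K (\bigcup_(i | P i) A i) (\sum_(i | P i) weight G (A i)) by [].
apply: (big_ind2 K).
- by rewrite /K sub0set /weight big_set0.
- move=> B1 s1 B2 s2 [B1E h1] [B2E h2]; split; first by rewrite subUset B1E.
  by apply: le_trans (weight_setU _ B2E) _; apply: lerD.
- by move=> i Pi; split; [apply: AE|].
Qed.

Definition walk_edges x p := [set e in pairmap (fun u v => [set u; v]%SET) x p].

Lemma walk_edges_path F x p : path (adj F) x p -> walk_edges x p \subset F.
Proof.
move=> xp; apply/subsetP => e; rewrite inE.
by elim: p x xp => //= y p IH x /andP[xy yp]; rewrite inE => /orP[/eqP->//|]; apply: IH.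
Qed.

Lemma path_walk_edges x p : path (adj (walk_edges x p)) x p.
Proof.
rewrite /walk_edges.
suff key (s : seq {set V}) : {subset pairmap (fun u v => [set u; v]%SET) x p <= s} ->
    path (adj [set e in s]) x p by exact: key.
elim: p x => //= y p IH x sub; apply/andP; split; last first.
  by apply: IH => e ep; apply: sub; rewrite inE ep orbT.
by rewrite /adj inE sub ?mem_head.
Qed.

Lemma weight_walk F x p : F \subset edges G -> path (adj F) x p ->
  weight G (walk_edges x p) <= walk_weight G x p.
Proof.
move=> FE xp; rewrite /weight /walk_weight /walk_edges.
have: {subset pairmap (fun u v : V => [set u; v]%SET) x p <= edges G}.
  by move=> e ep; apply: (subsetP FE); apply: (subsetP (walk_edges_path xp)); rewrite inE.
elim: (pairmap _ _ _) => [|e s IH] sE; first by rewrite big_nil big1// => e; rewrite inE.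
have sE' : {subset s <= edges G} by move=> f fs; apply: sE; rewrite inE fs orbT.
have e0 : 0 <= wt G e by apply/ltW/wt_gt0/sE/mem_head.
rewrite big_cons; have := IH sE'.
have -> : [set f in e :: s] = e |: [set f in s] by apply/setP => f; rewrite !inE.
have [es|es] := boolP (e \in [set f in s]); last by rewrite big_setU1//= lerD2l.
by rewrite (setUidPr _) ?sub1set// => h; apply: le_trans h _; rewrite lerDr.
Qed.

Lemma walk_weight_ge0 F x p : F \subset edges G -> path (adj F) x p ->
  0 <= walk_weight G x p.
Proof.
move=> FE xp; apply: le_trans (weight_walk FE xp); apply: weight_ge0.
exact: subset_trans (walk_edges_path xp) FE.
Qed.

Lemma walk_weight_cat x p q :
  walk_weight G x (p ++ q) = walk_weight G x p + walk_weight G (last x p) q.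
Proof. by rewrite /walk_weight pairmap_cat big_cat. Qed.

Lemma walk_rev F x p : path (adj F) x p ->
  exists q, [/\ path (adj F) (last x p) q, last (last x p) q = x &
    walk_weight G (last x p) q = walk_weight G x p].
Proof.
elim: p x => [|y p IH] x /=; first by exists [::].
move=> /andP[xy /IH[q [lq qy wq]]]; exists (rcons q x); split.
- by rewrite rcons_path lq qy /= /adj setUC.
- by rewrite last_rcons.
- rewrite -cats1 walk_weight_cat wq qy /walk_weight /= !big_cons big_nil addr0 addrC.
  by rewrite [in LHS]setUC.
Qed.

Lemma dist_le_walk F x y p : path (adj F) x p -> last x p = y ->
  (dist G F x y <= (walk_weight G x p)%:E)%E.
Proof. by move=> xp py; apply: ereal_inf_lbound; exists p. Qed.

Lemma dist_lt_walk F x y (t : R) : (dist G F x y < t%:E)%E ->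
  exists p, [/\ path (adj F) x p, last x p = y & walk_weight G x p < t].
Proof.
move=> /ereal_inf_lt[_ [p [xp py] <-]]; rewrite lte_fin => h; by exists p.
Qed.

Lemma dist_ge F x y (t : R) :
  (forall p, path (adj F) x p -> last x p = y -> t <= walk_weight G x p) ->
  (t%:E <= dist G F x y)%E.
Proof. by move=> h; apply: le_ereal_inf_tmp => _ [p [xp py] <-]; rewrite lee_fin; apply: h. Qed.

Lemma dist_mono F H x y : F \subset H -> (dist G H x y <= dist G F x y)%E.
Proof.
move=> FH; apply: ereal_inf_le_tmp => _ [p [xp py] <-]; exists p => //; split => //.
by apply: sub_path xp => a b; apply: (subsetP FH).
Qed.

Lemma dist_ge0 F x y : F \subset edges G -> (0 <= dist G F x y)%E.
Proof. by move=> FE; apply: dist_ge => p xp _; apply: walk_weight_ge0 FE xp. Qed.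

(** [fine] turns an infinite distance into 0, so this agrees with [dist] only when all vertices are
    connected, as [spans] demands. *)
Definition rdist F x y : R := fine (dist G F x y).

Definition spans F := F \subset edges G /\ forall x y, connect (adj F) x y.

Lemma spans_sub F H : spans F -> F \subset H -> H \subset edges G -> spans H.
Proof.
move=> [FE cF] FH HE; split => // x y; apply: connect_sub (cF x y) => a b ab.
by apply: connect1; apply: (subsetP FH).
Qed.

Lemma distE F x y : spans F -> dist G F x y = (rdist F x y)%:E.
Proof.
move=> [FE cF]; rewrite /rdist fineK// ge0_fin_numE ?dist_ge0//.
have /connectP[p xp ->] := cF x y.
exact: le_lt_trans (dist_le_walk xp erefl) (ltry _).
Qed.

Lemma rdist_le F H x y : spans F -> F \subset H -> H \subset edges G ->
  rdist H x y <= rdist F x y.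
Proof.
move=> sF FH HE; rewrite -lee_fin -!distE//; [exact: dist_mono|exact: spans_sub sF FH HE].
Qed.

Lemma rdist_walk F x y (t : R) : spans F -> rdist F x y < t ->
  exists p, [/\ path (adj F) x p, last x p = y & walk_weight G x p < t].
Proof. by move=> sF; rewrite -lte_fin -distE// => /dist_lt_walk. Qed.

Lemma rdist_le_walk F x p : spans F -> path (adj F) x p ->
  rdist F x (last x p) <= walk_weight G x p.
Proof. by move=> sF xp; rewrite -lee_fin -distE//; apply: dist_le_walk. Qed.

(** Distances are infima, so walks are reversed and concatenated that are optimal up to an arbitrary
    [e]. *)
Lemma rdist_pmetric F : spans F -> pmetric (rdist F).
Proof.
move=> sF; have le_rev x y : rdist F x y <= rdist F y x.
  apply/ler_addgt0Pr => e e0.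
  have [|p [yp px wp]] := rdist_walk (x := y) (y := x) (t := rdist F y x + e) sF; first lra.
  have [q [xq qy wq]] := walk_rev yp; rewrite px in xq qy wq.
  have := rdist_le_walk sF xq; rewrite qy wq; lra.
split.
- move=> x; apply/le_anti/andP; split.
    by have := rdist_le_walk (x := x) (p := [::]) sF isT; rewrite /walk_weight big_nil.
  by rewrite /rdist fine_ge0// dist_ge0//; case: sF.
- by move=> x y; apply/le_anti; rewrite !le_rev.
- move=> x y z; apply/ler_addgt0Pr => e e0; have e20 : 0 < e / 2 by lra.
  have [|p [xp py wp]] := rdist_walk (x := x) (y := y) (t := rdist F x y + e / 2) sF; first lra.
  have [|q [yq qz wq]] := rdist_walk (x := y) (y := z) (t := rdist F y z + e / 2) sF; first lra.
  have xpq : path (adj F) x (p ++ q) by rewrite cat_path xp py.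
  have := rdist_le_walk sF xpq; rewrite last_cat py qz walk_weight_cat py; lra.
Qed.

(* Inserting a new vertex y next to s and shifting everything to the right of s by twice the
   length of the edge sy keeps the line metric above the graph metric. *)
Lemma tour M : V -> spans M -> exists f : V -> R,
  (forall v, 0 <= f v <= 2 * weight G M) /\ forall u v, rdist M u v <= `|f u - f v|.
Proof.
move=> v0 sM; have [ME cM] := sM; have [m0 ms mt] := rdist_pmetric sM.
pose inner (S : {set V}) := [set e in M | e \subset S].
suff key n : (0 < n <= #|V|)%N -> exists (S : {set V}) (f : V -> R), [/\ #|S| = n,
    forall v, v \in S -> 0 <= f v <= 2 * weight G (inner S) &
    forall u v, u \in S -> v \in S -> rdist M u v <= `|f u - f v|].
  have [|S [f [cS fS fd]]] := key #|V|.
    by rewrite leqnn andbT; apply/card_gt0P; exists v0.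
  have ST v : v \in S.
    have /eqP-> : S == [set: V] by rewrite eqEcard subsetT cardsT cS leqnn.
    by rewrite inE.
  exists f; split=> [v|u v]; last exact: fd.
  have /andP[-> h] := fS v (ST v); apply: le_trans h _; rewrite ler_pM2l//.
  by apply: weight_mono ME _; apply/subsetP => e /setIdP[].
elim: n => // n IH /= nV; have [n0|n0] := posnP n.
  exists [set v0], (fun=> 0); split; first by rewrite n0 cards1.
    move=> v _; rewrite lexx/= mulr_ge0// weight_ge0//.
    by apply: subset_trans ME; apply/subsetP => e /setIdP[].
  by move=> u v /set1P-> /set1P->; rewrite m0 subrr normr0.
have [|S [f [cS fS fd]]] := IH; first by rewrite n0 ltnW.
have [y0 y0S] : exists y, y \notin S.
  have /subsetPn[y _ yS] : ~~ ([set: V] \subset S).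
    by apply/negP => /subset_leq_card; rewrite cardsT cS leqNgt nV.
  by exists y.
have [s0 s0S] : exists s, s \in S by apply/card_gt0P; rewrite cS.
have [s [y [sS yS sy]]] := connect_exit (S := fun v => v \in S) (cM s0 y0) s0S y0S.
pose w := wt G [set s; y]%SET.
have w0 : 0 < w by apply/wt_gt0/(subsetP ME).
have dsy : rdist M s y <= w.
  have := rdist_le_walk (x := s) (p := [:: y]) sM; rewrite /= sy => /(_ isT).
  by rewrite /walk_weight big_seq1.
pose g v := if v == y then f s + w else if f v <= f s then f v else f v + 2 * w.
have gS v : v \in S -> g v = if f v <= f s then f v else f v + 2 * w.
  by rewrite /g; case: eqVneq => // -> yS'; rewrite yS' in yS.
have gy : g y = f s + w by rewrite /g eqxx.
(* The new edge does not lie inside [S], so the bound on the length of the line grows by twice its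
   weight. *)
have inner_le : weight G (inner S) + w <= weight G (inner (y |: S)).
  have nin : [set s; y]%SET \notin inner S.
    apply/negP => /setIdP[_ /subsetP/(_ y)]; rewrite !inE eqxx orbT => /(_ isT).
    by rewrite (negPf yS).
  have -> : weight G (inner S) + w = weight G ([set s; y]%SET |: inner S).
    by rewrite /weight big_setU1//= addrC.
  apply: weight_mono; first by apply: subset_trans ME; apply/subsetP => e /setIdP[].
  apply/subsetP => e /setU1P[->|/setIdP[eM eS]]; apply/setIdP; split => //.
    by apply/subsetP => v /set2P[]->; rewrite !inE ?sS ?eqxx ?orbT.
  by apply: subset_trans eS _; apply: subsetUr.
exists (y |: S), g; split.
- by rewrite cardsU1 yS cS.
- have /andP[fs0 fs1] := fS s sS.
  move=> v /setU1P[->|vS]; first by rewrite gy; apply/andP; split; lra.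
  by rewrite gS//; have /andP[fv0 fv1] := fS v vS; case: ifP => _; apply/andP; split; lra.
- have half u v : u \in S -> v \in S -> f u <= f v -> rdist M u v <= `|g u - g v|.
    move=> uS vS uv; have := fd u v uS vS; rewrite !gS// distrC ger0_norm ?subr_ge0// => h.
    rewrite distrC; apply: le_trans (ler_norm _).
    by case: (lerP (f u) (f s)); case: (lerP (f v) (f s)); lra.
  have ycase v : v \in S -> rdist M v y <= `|g v - g y|.
    move=> vS; have := fd v s vS sS; have := mt v s y; rewrite gS// gy.
    have [vs|sv] := lerP (f v) (f s).
      move=> h1 h2; rewrite distrC; apply: le_trans (ler_norm _); lra.
    by move=> h1 h2; apply: le_trans (ler_norm _); lra.
  move=> u v /setU1P[->|uS] /setU1P[->|vS].
  + by rewrite m0.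
  + by rewrite ms distrC; apply: ycase.
  + exact: ycase.
  + have [uv|/ltW vu] := lerP (f u) (f v); first exact: half.
    by rewrite ms distrC; apply: half.
Qed.

End Walks.

(** * Graph distances as shortcuts in an ambient metric *)

Section Glue.
Variables (R : realType) (X V : finType) (pos : V -> X) (d0 : X -> X -> R).
Implicit Types delta : V -> V -> R.

(** The metric obtained from [d0] by adding shortcuts of length [delta] between the images of the
    vertices. When [delta] is a pseudometric dominated by [d0], one shortcut per route is enough:
    two shortcuts and the piece between them can be replaced by one. *)
Definition glue delta x y :=
  \big[Num.min/d0 x y]_(p : V * V) (d0 x (pos p.1) + delta p.1 p.2 + d0 (pos p.2) y).

Lemma glue_le0 delta x y : glue delta x y <= d0 x y.
Proof. exact: bigmin_le_id. Qed.

Lemma glue_le delta x y u v : glue delta x y <= d0 x (pos u) + delta u v + d0 (pos v) y.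
Proof. exact: (bigmin_le _ (u, v)). Qed.

Lemma glueP delta x y : d0 x y <= glue delta x y \/
  exists u v, d0 x (pos u) + delta u v + d0 (pos v) y <= glue delta x y.
Proof.
have := lexx (glue delta x y); rewrite {1}/glue => /bigmin_leP[h|[[u v] _ /= h]]; first by left.
by right; exists u, v.
Qed.

Lemma glue_mono delta delta' x y : (forall u v, delta' u v <= delta u v) ->
  glue delta' x y <= glue delta x y.
Proof.
move=> h; case: (glueP delta x y) => [h1|[u [v h1]]].
  exact: le_trans (glue_le0 _ _ _) h1.
have := glue_le delta' x y u v; have := h u v; lra.
Qed.

Lemma glue_pos delta u v : pmetric d0 -> pmetric delta ->
  (forall u v, delta u v <= d0 (pos u) (pos v)) -> glue delta (pos u) (pos v) = delta u v.
Proof.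
move=> [m0 ms mt] [n0 ns nt] le; apply/le_anti/andP; split.
  by have := glue_le delta (pos u) (pos v) u v; rewrite !m0; lra.
case: (glueP delta (pos u) (pos v)) => [|[a [b]]]; first exact: le_trans.
have := le u a; have := le b v; have := nt u a v; have := nt a b v; lra.
Qed.

Lemma glue_pmetric delta : pmetric d0 -> pmetric delta ->
  (forall u v, delta u v <= d0 (pos u) (pos v)) -> pmetric (glue delta).
Proof.
move=> pd0 pdel le; have [m0 ms mt] := pd0; have [n0 ns nt] := pdel; split.
- move=> x; apply/le_anti/andP; split; first by have := glue_le0 delta x x; rewrite m0.
  case: (glueP delta x x) => [|[a [b]]]; first by rewrite m0.
  have := pm_ge0 x (pos a) pd0; have := pm_ge0 (pos b) x pd0; have := pm_ge0 a b pdel; lra.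
- suff h x y : glue delta x y <= glue delta y x by move=> x y; apply/le_anti; rewrite !h.
  case: (glueP delta y x) => [|[a [b]]]; first by have := glue_le0 delta x y; rewrite (ms y x); lra.
  have := glue_le delta x y b a; rewrite (ns b a) (ms y (pos a)) (ms x (pos b)); lra.
- move=> x y z; case: (glueP delta x y) => [hxy|[a [b hxy]]];
    case: (glueP delta y z) => [hyz|[a' [b' hyz]]].
  + have := glue_le0 delta x z; have := mt x y z; lra.
  + have := glue_le delta x z a' b'; have := mt x y (pos a'); lra.
  + have := glue_le delta x z a b; have := mt (pos b) y z; lra.
  + have := glue_le delta x z a b'; have := mt (pos b) y (pos a'); have := le b a'.
    have := nt a b b'; have := nt b a' b'; lra.
Qed.

End Glue.

Lemma grid_cell (R : realType) (s t : R) n : 0 <= t <= n.+1%:R * s ->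
  exists2 k, (k < n.+1)%N & k%:R * s <= t <= k.+1%:R * s.
Proof.
elim: n => [|n IH] /andP[t0 tn]; first by exists 0%N => //; rewrite mul0r t0.
have [h|/ltW h] := lerP (n.+1%:R * s) t; first by exists n.+1 => //; rewrite h.
by have [|k kn hk] := IH; [rewrite t0|exists k => //; apply: ltnW].
Qed.

(** The line is cut into intervals of length at most [u]. The division points are added to the
    space, so that consecutive intervals have a common point and the nerve is connected. *)
Lemma line_skeleton (R : realType) (V : finType) (f : V -> R) (W u : R) :
  0 < W -> 0 < u -> (forall v, 0 <= f v <= W) ->
  exists (X : finType) (pos : V -> X) (d0 : X -> X -> R) (F : {set {set X}}),
  [/\ injective pos, pmetric d0, forall u v, d0 (pos u) (pos v) = `|f u - f v|,
    skeleton d0 (pos @: [set: V]) (4 * u) u F & cost d0 F <= W].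
Proof.
move=> W0 u0 fW.
have [n nW] : exists n, W / n.+1%:R <= u.
  exists (Num.truncn (W / u)); rewrite ler_pdivrMr ?ltr0n// -ler_pdivrMl// mulrC.
  by apply: ltW; apply: truncnS_gt.
pose s := W / n.+1%:R; have s0 : 0 < s by rewrite divr_gt0.
have ns : n.+1%:R * s = W by rewrite /s mulrC divfK// pnatr_eq0.
pose X : finType := (V + 'I_n.+1)%type.
pose fX (x : X) := match x with inl v => f v | inr k => k%:R * s end.
pose d0 x y := `|fX x - fX y|.
pose piece k : {set X} := [set x | k%:R * s <= fX x <= k.+1%:R * s].
pose F := [set piece k | k : 'I_n.+1 in [set: 'I_n.+1]].
have pd0 : pmetric d0.
  split; rewrite /d0; first by move=> x; rewrite subrr normr0.
    by move=> x y; rewrite distrC.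
  by move=> x y z; apply: ler_distD.
have dpiece k : diam d0 (piece k) <= s.
  apply: diam_le => [|x y]; first exact: ltW.
  by rewrite !inE -natr1 mulrDl mul1r => hx hy; rewrite /d0 ler_norml; apply/andP; split; lra.
exists X, inl, d0, F; split => //.
- by move=> a b [].
- have FP k : (k < n.+1)%N -> piece k \in F.
    by move=> kn; apply/imsetP; exists (Ordinal kn); rewrite ?inE.
  split.
  + have to0 k : (k < n.+1)%N -> connect (nerve F) (piece 0%N) (piece k).
      elim: k => [|k IH] kn; first exact: connect0.
      apply: (connect_trans (IH (ltnW kn))); apply: connect1.
      rewrite nerveE !FP ?(ltnW kn)//=; apply/set0Pn; exists (inr (Ordinal kn)).
      by rewrite !inE /= !lexx !ler_pM2r// !ler_nat !leqnSn.
    move=> _ _ /imsetP[i _ ->] /imsetP[j _ ->].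
    by apply: (connect_trans (y := piece 0%N)); [rewrite nerve_connect_sym|]; apply: to0.
  + move=> _ /imsetP[k _ ->]; apply: le_trans (dpiece k) _; apply: (le_trans nW).
    by move: u0; clear; lra.
  + move=> _ /imsetP[v _ ->].
    have [|k kn hk] := @grid_cell R s (f v) n; first by rewrite ns.
    exists (piece k); first exact: FP.
    by exists (inl v); rewrite ?inE//; case: pd0 => -> _ _; apply: ltW.
- apply: le_trans (cost_imset _ _ _) _.
  apply: (@le_trans _ _ (\sum_(k in [set: 'I_n.+1]) s)); first exact: ler_sum.
  by rewrite sumr_const cardsT card_ord -mulr_natl ns.
Qed.

Lemma oracle_dist (R : realType) (V : finType) (G : wgraph R V) (eps L : R)
    (O : oracle R V) (T : {set V}) x y : spans G (edges G) -> 0 < L -> 0 < eps ->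
  is_gsso G (1 + eps) O -> x \in T -> y \in T ->
  L <= rdist G (edges G) x y < 2 * L ->
  (dist G (O T L) x y <= ((1 + eps) * rdist G (edges G) x y)%:E)%E.
Proof.
move=> sE L0 e0 gO xT yT /andP[h1 h2].
have [E0 _ _] := rdist_pmetric sE.
have [_ gO'] := gO T L L0.
rewrite EFinM -(distE x y sE); apply: gO' => //; rewrite ?(distE x y sE) ?lee_fin ?lte_fin//.
by apply: contraTneq h1 => ->; rewrite E0 -ltNge.
Qed.

(** Calls at [L / 2], [L] and [2 * L] cover the range up to [4 * L], and [7 / 2] is the sum of the
    three factors. *)
Lemma oracle_scales (R : realType) (V : finType) (G : wgraph R V) (eps L Ws : R)
    (O : oracle R V) (T : {set V}) : spans G (edges G) -> 0 < L -> 0 < eps -> 0 <= Ws ->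
  is_gsso G (1 + eps) O ->
  (forall (T : {set V}) (L : R), 0 < L -> T != set0 ->
     weight G (O T L) <= Ws * (#|T|%:R * L)) ->
  exists D : {set {set V}}, [/\ D \subset edges G,
    weight G D <= Ws * (#|T|%:R * L) * (7 / 2) &
    forall x y, x \in T -> y \in T -> L / 2 <= rdist G (edges G) x y < 4 * L ->
      (dist G D x y <= ((1 + eps) * rdist G (edges G) x y)%:E)%E].
Proof.
move=> sE L0 e0 W0 gO OW; have [T0|T0] := eqVneq T set0.
  exists set0; split; first exact: sub0set.
    by rewrite /weight big_set0 T0 cards0 mul0r mulr0 mul0r.
  by move=> x y; rewrite T0 inE.
have L20 : 0 < L / 2 by rewrite divr_gt0.
have L2 : 0 < 2 * L by rewrite mulr_gt0.
have sub r : 0 < r -> O T r \subset edges G by move=> r0; have [] := gO T r r0.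
exists (O T (L / 2) :|: O T L :|: O T (2 * L)); split.
- by rewrite !subUset !sub.
- apply: le_trans (weight_setU _ (sub _ L2)) _.
  apply: le_trans (lerD (weight_setU _ (sub _ L0)) (lexx _)) _.
  apply: le_trans (lerD (lerD (OW _ _ L20 T0) (OW _ _ L0 T0)) (OW _ _ L2 T0)) _.
  by rewrite le_eqVlt; apply/orP; left; apply/eqP; field.
- set D := _ :|: O T (2 * L).
  move=> x y xT yT /andP[h1 h2]; pose r := rdist G (edges G) x y.
  have go l : O T l \subset D -> 0 < l -> l <= r < 2 * l ->
      (dist G D x y <= ((1 + eps) * r)%:E)%E.
    by move=> sl l0 hl; apply: le_trans (dist_mono _ _ _ sl) (oracle_dist sE l0 e0 gO xT yT hl).
  have [rL|Lr] := ltrP r L.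
    apply: (go (L / 2)) => //; first by rewrite /D -setUA subsetUl.
    by rewrite h1/=; move: rL; clear; lra.
  have [rL|L2r] := ltrP r (2 * L).
    apply: (go L) => //; last by rewrite Lr.
    by rewrite /D -setUA; apply: subsetU; rewrite subsetUl orbT.
  apply: (go (2 * L)) => //; first by rewrite /D subsetUr.
  by rewrite L2r/=; move: h2; rewrite -/r; clear; lra.
Qed.

(** As distances are infima, walks exceeding them by less than [t] stand for shortest paths. *)
Lemma short_walks (R : realType) (V : finType) (G : wgraph R V) (t : R) (K : {set V * V}) (b : R) :
  spans G (edges G) -> 0 < t -> 
  (forall e, e \in K -> rdist G (edges G) e.1 e.2 + t <= b) ->
  exists D : {set {set V}}, [/\ D \subset edges G, weight G D <= #|K|%:R * b &
    forall x y, (x, y) \in K -> (dist G D x y <= (rdist G (edges G) x y + t)%:E)%E].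
Proof.
move=> sE t0 Kb; have [EE cE] := sE.
have ex (e : V * V) : exists D : {set {set V}}, [/\ D \subset edges G,
    weight G D <= rdist G (edges G) e.1 e.2 + t &
    (dist G D e.1 e.2 <= (rdist G (edges G) e.1 e.2 + t)%:E)%E].
  have [|p [xp px wp]] := rdist_walk (x := e.1) (y := e.2) (t := rdist G (edges G) e.1 e.2 + t) sE.
    by rewrite ltrDl.
  exists (walk_edges e.1 p); split; first exact: walk_edges_path xp.
    exact: le_trans (weight_walk EE xp) (ltW wp).
  apply: le_trans (dist_le_walk _ (path_walk_edges _ _) px) _.
  by rewrite lee_fin ltW.
have [D DP] := choice ex; exists (\bigcup_(e in K) D e); split.
- by apply/bigcupsP => e _; case: (DP e).
- apply: le_trans (weight_bigcup _) _; first by move=> e _; case: (DP e).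
  rewrite mulr_natl -sumr_const; apply: ler_sum => e eK; have [_ h _] := DP e.
  exact: le_trans h (Kb e eK).
- move=> x y xyK; have [_ _ /= h] := DP (x, y); apply: le_trans h; apply: dist_mono.
  exact: (bigcup_sup (x, y)).
Qed.

(** * All scales *)

Lemma rdist_bound (R : realType) (V : finType) (G : wgraph R V) (F H : {set {set V}}) x y (t : R) :
  spans G H -> F \subset H -> (dist G F x y <= t%:E)%E -> rdist G H x y <= t.
Proof.
move=> sH FH h; rewrite -lee_fin -distE//; exact: le_trans (dist_mono _ _ _ FH) h.
Qed.

(** [level_step] is applied to the glued metric. The graph receives walks of weight at most [5 * L]
    for the pairs of [K] and the three oracle outputs for [T]; the bounds on the cardinals of [K]
    and [T] turn this into the two coefficients of the drop in cost. *)
Lemma scale_step (R : realType) (V X : finType) (G : wgraph R V) (pos : V -> X)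
    (d0 : X -> X -> R) (M H : {set {set V}}) (F : {set {set X}}) (u L eps Ws : R)
    (O : oracle R V) :
  injective pos -> pmetric d0 -> spans G M ->
  (forall a b, rdist G M a b <= d0 (pos a) (pos b)) ->
  M \subset H -> H \subset edges G -> 0 < u -> 100 * u <= L ->
  skeleton (glue pos d0 (rdist G H)) (pos @: [set: V]) (4 * u) u F ->
  0 < eps <= 1 -> is_gsso G (1 + eps) O -> 0 <= Ws ->
  (forall (T : {set V}) (L : R), 0 < L -> T != set0 ->
     weight G (O T L) <= Ws * (#|T|%:R * L)) ->
  exists (H' : {set {set V}}) (F' : {set {set X}}), [/\ H \subset H', H' \subset edges G,
    skeleton (glue pos d0 (rdist G H')) (pos @: [set: V]) (180 * L) (45 * L) F',
    forall x y, L <= rdist G (edges G) x y < 2 * L ->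
      rdist G H' x y <= (1 + eps) * rdist G (edges G) x y + 100 * u &
    weight G H' <= weight G H + (7 * Ws * (L / u) + 15 * (400 * 400) * (L / u) ^+ 2) *
      (cost (glue pos d0 (rdist G H)) F - cost (glue pos d0 (rdist G H')) F')].
Proof.
move=> ipos pd0 sM Md MH HE u0 uL skF /andP[e0 e1] gO Ws0 OW.
have L0 : 0 < L by move: u0 uL; clear; lra.
have sH := spans_sub sM MH HE.
have sE : spans G (edges G) := spans_sub sH HE (subxx _).
have ledge (H' : {set {set V}}) a b : M \subset H' -> H' \subset edges G ->
    rdist G H' a b <= d0 (pos a) (pos b).
  by move=> MH' H'E; apply: le_trans (rdist_le _ _ sM MH' H'E) (Md a b).
have pdH := glue_pmetric pd0 (rdist_pmetric sH) (fun a b => ledge H a b MH HE).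
have ME := subset_trans MH HE.
(* The extra [u] is the excess granted to the walks of [short_walks]. *)
pose w x y := glue pos d0 (rdist G (edges G)) x y + u.
have wE a b : w (pos a) (pos b) = rdist G (edges G) a b + u.
  rewrite /w glue_pos//; first exact: rdist_pmetric.
  by move=> ? ?; apply: ledge.
(* Moving both ends to net points changes a distance by at most [18 * u], hence a range wider than
   that of the conclusion. *)
pose inr a b := L / 2 <= rdist G (edges G) a b < 4 * L.
pose E := [set e | [exists a, exists b, (e == (pos a, pos b)) && inr a b]].
have EP p q : (p, q) \in E -> exists a b, [/\ p = pos a, q = pos b & inr a b].
  rewrite inE => /existsP[a /existsP[b /andP[/eqP[-> ->] ab]]].
  by exists a, b.
have EI a b : inr a b -> (pos a, pos b) \in E.
  by move=> ab; rewrite inE; apply/existsP; exists a; apply/existsP; exists b; rewrite eqxx.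
have EV p q : (p, q) \in E ->
    [/\ p \in pos @: [set: V], q \in pos @: [set: V] & 0 <= w p q <= 5 * L].
  move=> /EP[a [b [-> -> /andP[h1 h2]]]]; split; rewrite ?imset_f//.
  by rewrite wE; move: h1 h2 L0 u0 uL; clear => *; apply/andP; split; lra.
have [N [K [T [[NV KE TV] net cov gain]]]] := level_step pdH u0 uL skF EV.
pose KV := [set e : V * V | (pos e.1, pos e.2) \in K].
pose TT := [set v | pos v \in T].
have KVb e : e \in KV -> rdist G (edges G) e.1 e.2 + u <= 5 * L.
  rewrite inE => /(subsetP KE)/EP[a [b [/ipos-> /ipos-> /andP[_ h]]]].
  by move: h L0 u0 uL; clear; lra.
have cKV : #|KV|%:R <= (#|K|%:R : R).
  have ij : injective (fun e : V * V => (pos e.1, pos e.2)).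
    by move=> [a b] [a' b'] [/ipos-> /ipos->].
  rewrite ler_nat -(card_imset _ ij); apply: subset_leq_card.
  by apply/subsetP => _ /imsetP[e eK ->]; move: eK; rewrite inE.
have cTT : #|TT|%:R <= (#|T|%:R : R).
  rewrite ler_nat -(card_imset _ ipos); apply: subset_leq_card.
  by apply/subsetP => _ /imsetP[e eK ->]; move: eK; rewrite inE.
have [D1 [D1E wD1 dD1]] := short_walks sE u0 KVb.
have [D2 [D2E wD2 dD2]] := oracle_scales TT sE L0 e0 Ws0 gO OW.
pose H' := H :|: D1 :|: D2.
have H'E : H' \subset edges G by rewrite !subUset HE D1E.
have HH' : H \subset H' by rewrite /H' -setUA subsetUl.
have D1H' : D1 \subset H' by rewrite /H' setUAC subsetUr.
have D2H' : D2 \subset H' by rewrite subsetUr.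
have MH' := subset_trans MH HH'.
have sH' := spans_sub sM MH' H'E.
have pdH' := glue_pmetric pd0 (rdist_pmetric sH') (fun a b => ledge H' a b MH' H'E).
have gE (H0 : {set {set V}}) a b : spans G H0 -> M \subset H0 -> H0 \subset edges G ->
    glue pos d0 (rdist G H0) (pos a) (pos b) = rdist G H0 a b.
  move=> sH0 MH0 H0E; apply: glue_pos => //; first exact: rdist_pmetric.
  by move=> ? ?; apply: ledge.
have rHH' x y : glue pos d0 (rdist G H') x y <= glue pos d0 (rdist G H) x y.
  by apply: glue_mono => a b; apply: rdist_le.
have Kd a b : (pos a, pos b) \in K -> rdist G H' a b <= rdist G (edges G) a b + u.
  by move=> abK; apply: (rdist_bound sH' D1H'); apply: dD1; rewrite inE.
have Td a b : pos a \in T -> pos b \in T -> inr a b ->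
    rdist G H' a b <= (1 + eps) * rdist G (edges G) a b.
  by move=> aT bT ab; apply: (rdist_bound sH' D2H'); apply: dD2; rewrite ?inE.
have [||F' [skF' gT gK]] := gain _ pdH' rHH'.
- move=> p q pqK; have [a [b [pa qb ab]]] := EP p q (subsetP KE _ pqK).
  by move: pqK; rewrite pa qb wE gE//; apply: Kd.
- move=> p q /EP[a [b [-> -> ab]]] aT bT; rewrite gE//; apply: le_trans (Td a b aT bT ab) _.
  have /andP[h1 h2] := ab; apply: (@le_trans _ _ (2 * rdist G (edges G) a b)).
    by rewrite ler_wpM2r//; [move: h1 L0; clear; lra|move: e1; clear; lra].
  by move: h2 L0; clear; lra.
exists H', F'; split => //.
- move=> x y /andP[Lx xL].
  have [m0 ms mt] := rdist_pmetric sE.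
  have inVX v : pos v \in pos @: [set: V] by rewrite imset_f.
  have netV v : exists2 a, pos a \in N & rdist G H a v <= 9 * u.
    have [p pN pv] := net (pos v) (inVX v).
    have /imsetP[a _ pa] := subsetP NV p pN; exists a; first by rewrite -pa.
    by move: pv; rewrite pa gE.
  have [a aN ax] := netV x; have [b bN by_] := netV y.
  have leEH c d : rdist G (edges G) c d <= rdist G H c d by apply: rdist_le.
  have leH'H c d : rdist G H' c d <= rdist G H c d by apply: rdist_le.
  have [n0 ns nt] := rdist_pmetric sH'.
  have ab1 : rdist G (edges G) a b <= rdist G (edges G) x y + 18 * u.
    have := mt a x b; have := mt x y b; have := leEH a x; have := leEH b y.
    by rewrite (ms y b); move: ax by_; clear; lra.
  have ab2 : rdist G (edges G) x y <= rdist G (edges G) a b + 18 * u.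
    have := mt x a y; have := mt a b y; have := leEH a x; have := leEH b y.
    by rewrite (ms x a); move: ax by_; clear; lra.
  have H'xy : rdist G H' x y <= rdist G H' a b + 18 * u.
    have := nt x a y; have := nt a b y; have := leH'H a x; have := leH'H b y.
    by rewrite (ns x a); move: ax by_; clear; lra.
  have ab : inr a b by apply/andP; split; move: ab1 ab2 Lx xL uL u0; clear; lra.
  have r0 : 0 <= rdist G (edges G) a b by have /andP[+ _] := ab; move: L0; clear; lra.
  have rxy0 : 0 <= eps * rdist G (edges G) x y.
    by rewrite mulr_ge0 ?ltW//; apply: lt_le_trans L0 Lx.
  rewrite mulrDl mul1r.
  (* Moving the ends costs [18 * u] in [G] and [18 * u] in [H'], and the pair itself adds at most
     [41 * u]: all of this fits into [100 * u]. *)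
  case: (cov (pos a) (pos b) aN bN (EI a b ab)) => [h|[aT bT]|[p' [q' [pqK h]]]].
  + move: h; rewrite wE gE//; have := leH'H a b; move: H'xy ab1 rxy0 u0; clear; lra.
  + have := Td a b aT bT ab; rewrite mulrDl mul1r => h.
    have h1 : eps * rdist G (edges G) a b <= eps * rdist G (edges G) x y + 18 * u.
      apply: (@le_trans _ _ (eps * (rdist G (edges G) x y + 18 * u))); first by rewrite ler_pM2l.
      rewrite mulrDr lerD2l ler_piMl//; move: u0; clear; lra.
    by move: h h1 H'xy ab1 u0; clear; lra.
  + have [a' [b' [pa' qb' ab']]] := EP p' q' (subsetP KE _ pqK).
    move: pqK h; rewrite pa' qb' !wE !gE// => /Kd hK h.
    have := leH'H a a'; have := leH'H b' b; have := nt a a' b; have := nt a' b' b.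
    by move: hK h H'xy ab1 rxy0 u0; clear; lra.
- set g := cost _ F - cost _ F' in gT gK *.
  have -> : weight G H + (7 * Ws * (L / u) + 15 * (400 * 400) * (L / u) ^+ 2) * g =
     weight G H + 5 * L / u ^+ 2 * (3 * (400 * (400 * L)) * g) + Ws * L / u * (7 / 2) * (2 * g).
    by field; rewrite gt_eqF.
  apply: le_trans (weight_setU _ D2E) _; apply: lerD.
    apply: le_trans (weight_setU _ D1E) _; rewrite lerD2l; apply: le_trans wD1 _.
    have c0 : 0 <= 5 * L / u ^+ 2 by rewrite divr_ge0 ?sqr_ge0// mulr_ge0// ltW.
    apply: le_trans (ler_wpM2l c0 gK).
    have -> : 5 * L / u ^+ 2 * (#|K|%:R * u ^+ 2) = #|K|%:R * (5 * L) by field; rewrite gt_eqF.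
    by rewrite ler_pM2r// mulr_gt0.
  apply: le_trans wD2 _.
  have c0 : 0 <= Ws * L / u * (7 / 2) by rewrite mulr_ge0// ?divr_ge0// ?mulr_ge0// ltW.
  apply: le_trans (ler_wpM2l c0 gT).
  have -> : Ws * L / u * (7 / 2) * (#|T|%:R * u) = Ws * (#|T|%:R * L) * (7 / 2).
    by field; rewrite gt_eqF.
  by rewrite ler_pM2r ?divr_gt0// ler_wpM2l// ler_pM2r.
Qed.

Lemma skeleton_mono (R : realFieldType) (X : finType) (d d' : X -> X -> R) (V : {set X}) (D r : R)
    (F : {set {set X}}) :
  (forall x y, d' x y <= d x y) -> skeleton d V D r F -> skeleton d' V D r F.
Proof.
move=> le [cF FD FV]; split => // [C CF|v /FV[C CF [c cC vc]]].
  exact: le_trans (diam_mono C le) (FD C CF).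
by exists C => //; exists c => //; apply: le_trans (le v c) vc.
Qed.

(** Induction on the scales: the weight plus [A] times the cost of the skeleton never exceeds its
    initial bound, since each scale pays for its edges by lowering the cost. *)
Lemma class_spanner (R : realType) (V : finType) (G : wgraph R V) (M : {set {set V}})
    (O : oracle R V) (eps delta L0 Ws : R) n :
  spans G M -> 0 < weight G M -> 0 < delta -> 100 * (45 * delta) <= eps -> 0 < eps <= 1 ->
  0 < L0 -> is_gsso G (1 + eps) O -> 0 <= Ws ->
  (forall (T : {set V}) (L : R), 0 < L -> T != set0 ->
     weight G (O T L) <= Ws * (#|T|%:R * L)) ->
  exists H : {set {set V}}, [/\ M \subset H, H \subset edges G,
    forall i x y, (i < n)%N -> L0 / delta ^+ i <= rdist G (edges G) x y < 2 * (L0 / delta ^+ i) ->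
      rdist G H x y <= (1 + 2 * eps) * rdist G (edges G) x y &
    weight G H <= weight G M * (1 + 2 * (7 * Ws * (45 * delta)^-1 +
      15 * (400 * 400) * ((45 * delta)^-1) ^+ 2))].
Proof.
move=> sM W0 de0 de he L00 gO Ws0 OW; have /andP[e0 e1] := he.
have [ME cM] := sM.
have [v0 _] : exists v0 : V, v0 \in [set: V].
  have [E|[v vV]] := set_0Vmem [set: V]; last by exists v.
  have M0 : M = set0.
    apply/setP => e; rewrite inE; apply/negP => /(subsetP ME)/edges_card2 e2.
    by have := subset_leq_card (subsetT e); rewrite e2 E cards0.
  by move: W0; rewrite M0 /weight big_set0 ltxx.
have [f [fW fd]] := tour v0 sM.
pose L i := L0 / delta ^+ i.
have L_gt0 i : 0 < L i by rewrite divr_gt0// exprn_gt0.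
(* The skeleton left by scale [L i] has unit [45 * L i], which is [u i.+1]. The hypothesis on
   [delta] makes the error [100 * u i] at most [eps * L i]. *)
pose u i := 45 * delta * L i.
have u_gt0 i : 0 < u i by apply: mulr_gt0 (L_gt0 i); rewrite mulr_gt0.
have W20 : 0 < 2 * weight G M by rewrite mulr_gt0.
have [X [pos [d0 [F0 [ipos pd0 dE skF0 costF0]]]]] := line_skeleton W20 (u_gt0 0%N) fW.
have Md a b : rdist G M a b <= d0 (pos a) (pos b) by rewrite dE.
set A := 7 * Ws * (45 * delta)^-1 + 15 * (400 * 400) * ((45 * delta)^-1) ^+ 2.
have A0 : 0 <= A.
  have k0 : 0 <= (45 * delta)^-1 by rewrite invr_ge0 mulr_ge0// ltW.
  apply: addr_ge0; first by apply: mulr_ge0 k0; rewrite mulr_ge0.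
  apply: mulr_ge0 (sqr_ge0 _); apply: mulr_ge0; first exact: ler0n.
  apply: mulr_ge0; exact: ler0n.
suff [H [F [MH HE skF cov wH]]] : exists (H : {set {set V}}) (F : {set {set X}}),
    [/\ M \subset H, H \subset edges G,
    skeleton (glue pos d0 (rdist G H)) (pos @: [set: V]) (4 * u n) (u n) F,
    forall i x y, (i < n)%N -> L i <= rdist G (edges G) x y < 2 * L i ->
      rdist G H x y <= (1 + 2 * eps) * rdist G (edges G) x y &
    weight G H + A * cost (glue pos d0 (rdist G H)) F <= weight G M + A * (2 * weight G M)].
  exists H; split => //; have := mulr_ge0 A0 (cost_ge0 (glue pos d0 (rdist G H)) F).
  have -> : weight G M * (1 + 2 * A) = weight G M + A * (2 * weight G M) by ring.
  by move: wH; clear; lra.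
have glue0 H x y : glue pos d0 (rdist G H) x y <= d0 x y by exact: glue_le0.
elim: n => [|n [H [F [MH HE skF cov wH]]]].
  exists M, F0; split => //; first exact: skeleton_mono skF0.
  by rewrite lerD2l ler_wpM2l//; apply: le_trans (cost_mono F0 (glue0 M)) costF0.
have uL : 100 * u n <= L n.
  have -> : 100 * u n = 100 * (45 * delta) * L n by rewrite /u; ring.
  exact: ler_piMl (ltW (L_gt0 n)) (le_trans de e1).
have [H' [F' [HH' H'E skF' cov' wH']]] :=
  scale_step ipos pd0 sM Md MH HE (u_gt0 n) uL skF he gO Ws0 OW.
have Lu : L n / u n = (45 * delta)^-1.
  by rewrite /u; field; rewrite !gt_eqF ?L_gt0.
have uS : u n.+1 = 45 * L n.
  by rewrite /u /L exprS; field; rewrite !gt_eqF ?exprn_gt0.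
exists H', F'; split => //.
- exact: subset_trans MH HH'.
- have -> : 4 * u n.+1 = 180 * L n by rewrite uS; ring.
  by rewrite uS.
- move=> i x y; rewrite ltnS leq_eqVlt => /orP[/eqP->|il] hxy; last first.
    by apply: le_trans (cov i x y il hxy); apply: rdist_le => //; apply: spans_sub sM MH HE.
  apply: le_trans (cov' x y hxy) _; have /andP[Lx _] := hxy.
  have : 100 * u n <= eps * rdist G (edges G) x y.
    have -> : 100 * u n = 100 * (45 * delta) * L n by rewrite /u; ring.
    apply: ler_pM _ (ltW (L_gt0 n)) de Lx; apply: mulr_ge0; first exact: ler0n.
    by apply: mulr_ge0 (ltW de0); apply: ler0n.
  have -> : (1 + 2 * eps) * rdist G (edges G) x y =
    (1 + eps) * rdist G (edges G) x y + eps * rdist G (edges G) x y by ring.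
  by clear; lra.
- move: wH'; rewrite Lu -/A mulrBr; move: wH; clear; lra.
Qed.

(** * Classes of scales and the final constants *)

Lemma pow2_above (R : realType) (t : R) : 1 <= t -> exists m, t <= 2 ^+ m <= 2 * t.
Proof.
move=> t1; have ex : exists m, t <= 2 ^+ m.
  exists (Num.truncn t).+1; apply: ltW; apply: lt_le_trans (truncnS_gt t) _.
  by rewrite -natrX ler_nat ltnW// ltn_expl.
exists (ex_minn ex); case: ex_minnP => m tm mmin; rewrite tm /=.
case: m tm mmin => [|m] tm mmin; first by rewrite expr0; move: t1; clear; lra.
rewrite exprS ler_pM2l//; apply/ltW; rewrite ltNge; apply/negP => h.
by have := mmin _ h; rewrite ltnn.
Qed.

Lemma pow2_below (R : realType) (t : R) : 1 <= t -> exists k, 2 ^+ k <= t < 2 * 2 ^+ k.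
Proof.
move=> t1; have [m /andP[h1 h2]] := pow2_above t1; have [h|h] := leP (2 ^+ m) t.
  exists m; rewrite h /=; apply: le_lt_trans h1 _.
  by rewrite ltr_pMl ?exprn_gt0// ltr1n.
case: m h1 h2 h => [|m] h1 h2 h; first by move: h; rewrite expr0 ltNge t1.
exists m; rewrite -exprS h andbT; move: h2; rewrite exprS ler_pM2l//.
Qed.

Lemma min_dist (R : realType) (V : finType) (G : wgraph R V) : spans G (edges G) ->
  exists2 w : R, 0 < w & forall x y, x != y -> w <= rdist G (edges G) x y.
Proof.
(* The base value 1 keeps the minimum positive when there are no edges. *)
move=> sE; exists (\big[Num.min/1]_(e in edges G) wt G e).
  by apply/bigmin_gtP; split => // e; apply: wt_gt0.
move=> x y xy; rewrite -lee_fin -distE//; apply: dist_ge => -[|z p] /=.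
  by move=> _ xy'; rewrite xy' eqxx in xy.
move=> /andP[xz zp] _; have [EE _] := sE.
rewrite /walk_weight /= big_cons; apply: (@le_trans _ _ (wt G [set x; z]%SET)).
  exact: bigmin_le_cond.
by rewrite lerDl; apply: walk_weight_ge0 EE zp.
Qed.

Lemma weak_sparsity_ge0 (R : realType) (V : finType) (G : wgraph R V) (O : oracle R V) :
  (0 <= weak_sparsity G O)%E.
Proof.
apply: ereal_sup_ubound; exists set0, 1; split => //.
by rewrite cards0 mul0r invr0 mulr0.
Qed.

Lemma weak_sparsity_le (R : realType) (V : finType) (G : wgraph R V) (O : oracle R V) (Ws : R)
    (T : {set V}) (L : R) : weak_sparsity G O = Ws%:E -> 0 < L -> T != set0 ->
  weight G (O T L) <= Ws * (#|T|%:R * L).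
Proof.
move=> WsE L0 T0; have TL : 0 < #|T|%:R * L by rewrite mulr_gt0// ltr0n card_gt0.
rewrite -ler_pdivrMr// -lee_fin -WsE; apply: ereal_sup_ubound.
by exists T, L.
Qed.

(** With [delta] the inverse of [2 ^+ m], the scales [w * 2 ^+ k] fall into [m] classes according to
    [k] modulo [m]. The union of the [m] class spanners is taken, whence the factor [m]. *)
Lemma finite_sparsity_spanner (R : realType) (V : finType) (G : wgraph R V) (M : {set {set V}})
    (O : oracle R V) (eps Ws : R) m :
  spans G M -> 0 < weight G M -> 0 < eps <= 1 -> is_gsso G (1 + eps) O -> 0 <= Ws ->
  (forall (T : {set V}) (L : R), 0 < L -> T != set0 ->
     weight G (O T L) <= Ws * (#|T|%:R * L)) ->
  (0 < m)%N -> 100 * (45 / eps) <= 2 ^+ m ->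
  exists H : {set {set V}}, is_spanner G (1 + 2 * eps) H /\
    weight G H <= m%:R * (weight G M * (1 + 2 * (7 * Ws * (2 ^+ m / 45) +
      15 * (400 * 400) * (2 ^+ m / 45) ^+ 2))).
Proof.
move=> sM W0 he gO Ws0 OW m0 hm; have /andP[e0 e1] := he; have [ME cM] := sM.
have sE : spans G (edges G) := spans_sub sM ME (subxx _).
have [w w0 wd] := min_dist sE.
pose delta : R := (2 ^+ m)^-1.
have de0 : 0 < delta by rewrite invr_gt0 exprn_gt0.
have de : 100 * (45 * delta) <= eps.
  have -> : 100 * (45 * delta) = 100 * (45 / eps) * (eps * delta).
    by field; rewrite gt_eqF.
  apply: (@le_trans _ _ (2 ^+ m * (eps * delta))); first by rewrite ler_pM2r// mulr_gt0.
  by rewrite mulrCA divff ?mulr1// expf_neq0.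
have dE : (45 * delta)^-1 = 2 ^+ m / 45 by rewrite invfM invrK mulrC.
(* A crude bound on all distances in units of [w], so that finitely many scales suffice. *)
pose B := \sum_x \sum_y rdist G (edges G) x y / w.
have rw0 x y : 0 <= rdist G (edges G) x y / w.
  by apply: divr_ge0 (ltW w0); apply/pm_ge0/rdist_pmetric.
have leB x y : rdist G (edges G) x y / w <= B.
  rewrite /B (bigD1 x)//= (bigD1 y)//= -addrA lerDl.
  by rewrite addr_ge0//; apply: sumr_ge0 => // i _; apply: sumr_ge0.
have [n nB] : exists n, B < 2 ^+ n.
  exists (Num.truncn B).+1; apply: lt_le_trans (truncnS_gt B) _.
  by rewrite -natrX ler_nat ltnW// ltn_expl.
have ex k : exists H : {set {set V}}, [/\ M \subset H, H \subset edges G,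
    forall i x y, (i < n)%N ->
      w * 2 ^+ k / delta ^+ i <= rdist G (edges G) x y < 2 * (w * 2 ^+ k / delta ^+ i) ->
      rdist G H x y <= (1 + 2 * eps) * rdist G (edges G) x y &
    weight G H <= weight G M * (1 + 2 * (7 * Ws * (45 * delta)^-1 +
      15 * (400 * 400) * ((45 * delta)^-1) ^+ 2))].
  have k0 : 0 < w * 2 ^+ k by rewrite mulr_gt0// exprn_gt0.
  exact: class_spanner sM W0 de0 de he k0 gO Ws0 OW.
have [Hk HkP] := choice ex.
pose H := \bigcup_(k < m) Hk k.
have HE : H \subset edges G by apply/bigcupsP => k _; case: (HkP k).
have MH : M \subset H.
  have [MHk _ _ _] := HkP 0%N; apply: (subset_trans MHk).
  exact: (bigcup_sup (Ordinal m0)).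
have sH := spans_sub sM MH HE.
have [n0 ns nt] := rdist_pmetric sH.
have [m00 ms mt] := rdist_pmetric sE.
exists H; split; first split=> //.
- move=> x y; rewrite (distE x y sH) (distE x y sE) -EFinM lee_fin.
  have [->|xy] := eqVneq x y; first by rewrite n0 m00 mulr0.
  pose t := rdist G (edges G) x y / w.
  have [k /andP[kt tk]] : exists k, 2 ^+ k <= t < 2 * 2 ^+ k.
    by apply: pow2_below; rewrite ler_pdivlMr// mul1r wd.
  have kn : (k < n)%N.
    have : 2 ^+ k < 2 ^+ n :> R by apply: le_lt_trans kt (le_lt_trans (leB x y) nB).
    by rewrite ltr_eXn2l// ltr1n.
  have [MHk HkE cov _] := HkP (k %% m)%N.
  have lt_km : (k %% m < m)%N by rewrite ltn_mod.
  have sHk : Hk (k %% m)%N \subset H by exact: (bigcup_sup (Ordinal lt_km)).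
  apply: le_trans (rdist_le _ _ (spans_sub sM MHk HkE) sHk HE) _.
  apply: (cov (k %/ m)%N); first exact: leq_ltn_trans (leq_div _ _) kn.
  have -> : w * 2 ^+ (k %% m) / delta ^+ (k %/ m) = w * 2 ^+ k.
    rewrite /delta exprVn invrK -mulrA -exprM -exprD addnC mulnC -divn_eq//.
  have xyE : rdist G (edges G) x y = w * t by rewrite /t mulrC divfK// gt_eqF.
  by rewrite xyE ler_pM2l// kt /= (mulrCA 2) ltr_pM2l.
- apply: le_trans (weight_bigcup _) _; first by move=> k _; case: (HkP k).
  rewrite mulr_natl -[X in _ *+ X]card_ord -sumr_const; apply: ler_sum => k _.
  by have [_ _ _] := HkP k; rewrite dE.
Qed.

Lemma edges_spanner (R : realType) (V : finType) (G : wgraph R V) (s : R) :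
  spans G (edges G) -> 1 <= s -> is_spanner G s (edges G).
Proof.
move=> sE s1; split => // x y; rewrite (distE x y sE) -EFinM lee_fin ler_peMl//.
exact: pm_ge0 (rdist_pmetric sE).
Qed.

(** The constant [2 * (100 * 45)] is at most [2 ^+ 14], and [ln 2 <= ln (eps^-1)] turns the 14
    summands [ln 2] into 14 copies of [ln (eps^-1)]; one more comes from [eps^-1] itself. *)
Lemma pow2_log (R : realType) (m : nat) (eps : R) : 0 < eps <= 2^-1 ->
  2 ^+ m <= 2 * (100 * (45 / eps)) -> m%:R <= 15 / ln 2 * ln (eps^-1).
Proof.
move=> /andP[e0 e2] hm; have l2 : 0 < ln (2 : R) by rewrite ln_gt0// ltr1n.
have einv : 0 < eps^-1 by rewrite invr_gt0.
have l2e : ln 2 <= ln (eps^-1).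
  by rewrite ler_ln ?posrE// -(invrK 2) lef_pV2 ?posrE// invr_gt0.
have : ln (2 ^+ m) <= ln (2 ^+ 14 * eps^-1).
  rewrite ler_ln ?posrE ?mulr_gt0 ?exprn_gt0//; apply: (le_trans hm).
  have -> : 2 * (100 * (45 / eps)) = 2 * (100 * 45) * eps^-1 by ring.
  rewrite ler_pM2r//; clear.
  have -> : 2 ^+ 14 = 2 * (2 ^+ 7 * 2 ^+ 6) :> R by ring.
  by rewrite ler_pM2l//; apply: ler_pM => //; rewrite -natrX ler_nat.
rewrite lnM ?posrE ?exprn_gt0// !lnXn// => h.
have -> : 15 / ln 2 * ln (eps^-1) = 15 * ln (eps^-1) / ln 2 by ring.
rewrite -[ln 2 *+ m]mulr_natl -[ln 2 *+ 14]mulr_natl in h.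
rewrite ler_pdivlMr//; apply: (le_trans h).
by move: l2e; clear; lra.
Qed.

(** Here [k] stands for [2 ^+ m / 45] and [N] for [400 * 400]. The summand 1 is absorbed by
    [eps ^- 2]. *)
Lemma lightness_bound (R : realType) (N Ws eps k : R) : 0 <= N -> 0 <= Ws -> 0 < eps <= 1 ->
  0 <= k <= 200 / eps ->
  1 + 2 * (7 * Ws * k + 15 * N * k ^+ 2) <=
    (14 * 200 + (1 + 30 * N * (200 * 200))) * (Ws * eps^-1 + eps ^- 2).
Proof.
move=> N0 Ws0 /andP[e0 e1] /andP[k0 ke].
have i1 : 1 <= eps^-1 by rewrite invf_ge1.
have i2 : 1 <= eps ^- 2 by rewrite -exprVn exprn_ege1.
have h1 : 14 * (Ws * k) <= 14 * (Ws * (200 / eps)) by rewrite ler_pM2l// ler_wpM2l.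
have h2 : k ^+ 2 <= (200 / eps) ^+ 2 by rewrite ler_sqr ?nnegrE// (le_trans k0).
have h3 : N * k ^+ 2 <= N * (200 / eps) ^+ 2 by rewrite ler_wpM2l.
have e2 : (200 / eps) ^+ 2 = 200 * 200 * eps ^- 2 by rewrite exprMn exprVn expr2.
rewrite e2 in h3.
have q : 0 <= 200 * 200 :> R by apply: mulr_ge0; apply: ler0n.
have p1 : 0 <= Ws * eps^-1 by rewrite mulr_ge0// invr_ge0 ltW.
have p2 : 0 <= N * (200 * 200) * (Ws * eps^-1) by exact: mulr_ge0 (mulr_ge0 N0 q) p1.
have -> : (14 * 200 + (1 + 30 * N * (200 * 200))) * (Ws * eps^-1 + eps ^- 2) =
  14 * (Ws * (200 / eps)) + 14 * 200 * eps ^- 2 + Ws * eps^-1 + eps ^- 2 +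
  30 * (N * (200 * 200) * (Ws * eps^-1)) + 30 * (N * (200 * 200 * eps ^- 2)) by ring.
have -> : 1 + 2 * (7 * Ws * k + 15 * N * k ^+ 2) = 1 + 14 * (Ws * k) + 30 * (N * k ^+ 2) by ring.
move: h1 h3 i2 p1 p2; clear; lra.
Qed.

Local Open Scope classical_set_scope.

Theorem theorem1p13 (R : realType) :
  exists c1 c2 : R, 0 < c1 /\ 0 < c2 /\
    forall (V : finType) (G : wgraph R V) (M : {set {set V}})
           (O : R -> oracle R V),
      is_mst G M ->
      (forall eps : R, 0 < eps -> is_gsso G (1 + eps) (O eps)) ->
      forall eps : R, 0 < eps -> eps <= 2^-1 ->
        exists H : {set {set V}},
          is_spanner G (1 + c1 * eps) H /\
          ((lightness G M H)%:E <=
             (c2 * ln (eps^-1))%:E *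
             (weak_sparsity G (O eps) * (eps^-1)%:E + (eps ^- 2)%:E))%E.
Proof.
have [N [N0 NE]] : exists N : R, 0 <= N /\ N = 400 * 400.
  by exists (400 * 400); split; [apply: mulr_ge0; apply: ler0n|exact: erefl].
pose C : R := 14 * 200 + (1 + 30 * N * (200 * 200)).
have C0 : 0 < C.
  have h : 0 <= 30 * N * (200 * 200).
    apply: mulr_ge0; first by apply: mulr_ge0 N0; apply: ler0n.
    by apply: mulr_ge0; apply: ler0n.
  by rewrite /C; move: h; clear; lra.
have l2 : 0 < ln (2 : R) by rewrite ln_gt0// ltr1n.
exists 2, (15 / ln 2 * C); split; first by [].
split; first by rewrite mulr_gt0// divr_gt0.
move=> V G M O [[ME cM _] _] gO eps e0 e2.
have e1 : eps <= 1 by apply: (le_trans e2); rewrite invf_le1// ler1n.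
have sM : spans G M by [].
have sE : spans G (edges G) := spans_sub sM ME (subxx _).
have le0 : 0 < ln (eps^-1).
  by rewrite ln_gt0// invf_gt1//; apply: (le_lt_trans e2); rewrite invf_lt1// ltr1n.
have c0 : 0 < 15 / ln 2 * C * ln (eps^-1) by rewrite !mulr_gt0// invr_gt0.
have i0 : 0 < eps^-1 by rewrite invr_gt0.
have i20 : 0 < eps ^- 2 by rewrite invr_gt0 exprn_gt0.
have Es : is_spanner G (1 + 2 * eps) (edges G).
  by apply: edges_spanner sE _; rewrite lerDl mulr_ge0// ltW.
have := weak_sparsity_ge0 G (O eps); case WE : (weak_sparsity G (O eps)) => [Ws||] //.
- rewrite lee_fin => Ws0.
  have [W0|W0] := leP (weight G M) 0.
    (* For a tree of weight 0 the lightness is 0 by division by zero, so the whole graph serves. *)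
    exists (edges G); split => //; rewrite /lightness -EFinM lee_fin.
    have -> : weight G M = 0 by apply/le_anti; rewrite W0 weight_ge0.
    rewrite invr0 mulr0; apply: mulr_ge0 (ltW c0) _.
    by apply: addr_ge0 (ltW i20); apply: mulr_ge0 (ltW i0).
  have t1 : 1 <= 100 * (45 / eps).
    by rewrite mulrA ler_pdivlMr// mul1r; apply: (le_trans e1); rewrite -natrM ler1n.
  (* This places [2 ^+ m] between [4500 / eps] and twice that, so that [delta] is of order [eps]. *)
  have [m /andP[tm mt]] := pow2_above t1.
  have m0 : (0 < m)%N.
    case: m tm {mt} => // ; rewrite expr0 mulrA ler_pdivrMr// mul1r => h.
    by have := le_trans h e1; rewrite -natrM lern1.
  have he : 0 < eps <= 1 by rewrite e0.
  have OW := weak_sparsity_le WE.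
  have [H [spH wH]] := finite_sparsity_spanner sM W0 he (gO eps e0) Ws0 OW m0 tm.
  exists H; split => //; rewrite /lightness -EFinM lee_fin ler_pdivrMr//.
  apply: (le_trans wH); rewrite mulrCA [leRHS]mulrC ler_pM2l// -NE.
  have he2 : 0 < eps <= 2^-1 by rewrite e0.
  have hm := pow2_log he2 mt.
  have hk : 0 <= (2 : R) ^+ m / 45 <= 200 / eps.
    rewrite divr_ge0 ?exprn_ge0//= ler_pdivrMr//; apply: (le_trans mt).
    by have -> : 2 * (100 * (45 / eps)) = 200 / eps * 45 by field; rewrite gt_eqF.
  have hb := lightness_bound N0 Ws0 he hk.
  have -> : 15 / ln 2 * C * ln (eps^-1) * (Ws * eps^-1 + eps ^- 2) =
    15 / ln 2 * ln (eps^-1) * (C * (Ws * eps^-1 + eps ^- 2)) by ring.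
  apply: ler_pM => //.
  by rewrite addr_ge0// mulr_ge0// addr_ge0// !mulr_ge0// ?sqr_ge0// divr_ge0// exprn_ge0.
(* For infinite weak sparsity the bound is infinite, so the whole graph serves. *)
- move=> _; exists (edges G); split => //.
  rewrite gt0_mulye ?lte_fin// addye// gt0_muley ?lte_fin// leey//.
Qed.
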